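(* For every integer $n\geq1$, $\mathrm{unc}(n,3)<(1.56)\,3^{n^2-n-1}(1.59)^n$, and for every prime power $q\geq4$, \[ \mathrm{unc}(n,q)<c^*(q)\,q^{n^2-n-1}\bigl(1+q^{-1}+2q^{-2}\bigr)^n . \] Moreover $1<c^*(q)<1.56$ for all prime powers $q\geq3$.
   Context: $\mathrm{M}(n,q)$ is the algebra of $n\times n$ matrices over $\mathbb{F}_q$. For $X\in\mathrm{M}(n,q)$ let $V=\mathbb{F}_q^{1\times n}$ be an $\mathbb{F}_q[t]$-module with $t$ acting as $X$; for monic irreducible $g$, $V(g)=\ker g(X)^n$. $X$ is uncyclic if $V(g)$ is a non-cyclic $\mathbb{F}_q[X]$-module for every monic irreducible divisor $g$ of $c_X(t)$; $\mathrm{unc}(n,q)$ is the number of uncyclic matrices in $\mathrm{M}(n,q)$. For real $Q>1$: $\omega(m,Q)=\prod_{i=1}^m(1-Q^{-i})$, $\omega(\infty,Q)=\prod_{i=1}^\infty(1-Q^{-i})$, $c_0(\infty,Q)=Q^2\bigl(1-\prod_{i=2}^\infty(1-Q^{-i})\bigr)$, and \[ c^*(q)=c_0(\infty,q)+q\,\frac{\omega(4,q)\,c_0(\infty,q^2)}{\omega(\infty,q^2)}\Bigl(q\log(1-q^{-2})-\log(1-q^{-1})\Bigr). \] *)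

(* Defs.v *)
From HB Require Import structures.
From mathcomp Require Import all_boot all_order all_algebra.
From Stdlib Require Import Reals ClassicalEpsilon.
Set Implicit Arguments. Unset Strict Implicit. Unset Printing Implicit Defensive.
Import GRing.Theory.

Section Unc.
Variable F : finFieldType.

Local Open Scope ring_scope.

(* Evaluation g(X) of a polynomial at a square matrix (any size n, including
   sizes where mathcomp's horner_mx is not available). *)
Definition mx_eval (n : nat) (p : {poly F}) (X : 'M[F]_n) : 'M[F]_n :=
  \sum_(i < size p) p`_i *: X ^+ i.

(* V = F^{1 x n} with t acting as v |-> v X.  V(g) = ker g(X)^n, as a
   row-space (kermx M spans { v | v *m M = 0 }). *)
Definition Vg (n : nat) (X : 'M[F]_n) (g : {poly F}) : 'M[F]_n :=
  kermx (mx_eval g X ^+ n).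

(* A subspace W (row space of W), assumed X-invariant, is a cyclic
   F[X]-module: there is v in W with W = F[X] v = { v p(X) | p in F[t] }. *)
Definition cyclic_mod (n : nat) (X : 'M[F]_n) (W : 'M[F]_n) : Prop :=
  exists2 v : 'rV[F]_n, (v <= W)%MS &
    forall w : 'rV[F]_n, (w <= W)%MS -> exists p : {poly F}, w = v *m mx_eval p X.

Definition uncyclic (n : nat) (X : 'M[F]_n) : Prop :=
  forall g : {poly F}, g \is monic -> irreducible_poly g -> g %| char_poly X ->
    ~ cyclic_mod X (Vg X g).

End Unc.

Definition asbool (P : Prop) : bool :=
  if excluded_middle_informative P then true else false.

Definition unc (F : finFieldType) (n : nat) : nat :=
  #|[set X : 'M[F]_n | asbool (uncyclic X)]|.

Local Open Scope R_scope.

Fixpoint prodR (f : nat -> R) (m : nat) : R :=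
  match m with
  | O => 1
  | S k => prodR f k * f (S k)
  end.

Definition Lim (u : nat -> R) : R :=
  epsilon (inhabits 0) (fun l => Un_cv u l).

Definition omega_fin (m : nat) (Q : R) : R := prodR (fun i => 1 - / Q ^ i) m.

Definition omega_inf (Q : R) : R := Lim (fun m => omega_fin m Q).

Definition c0_inf (Q : R) : R :=
  Q ^ 2 * (1 - Lim (fun m => prodR (fun i => 1 - / Q ^ (S i)) m)).

Definition cstar (q : R) : R :=
  c0_inf q + q * (omega_fin 4 q * c0_inf (q ^ 2) / omega_inf (q ^ 2))
               * (q * ln (1 - / q ^ 2) - ln (1 - / q)).

(* Main.v *)
(** Write q for the size of the field, and divide the number of matrices of a
    given kind by |GL(n,q)|.  If every matrix of a class has an invariant
    subspace on which it acts as a member of class 1 and modulo which it acts as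
    a member of class 2, then its weight is at most the product of the weights of
    classes 1 and 2.

    Primary matrices.  Let g be irreducible of degree d, Q = q^d, and nu(m) the
    weight of the dm x dm matrices killed by a power of g.  Sorting the pairs
    (X, v) by the annihilator g^j of v gives Q^m nu(m) <= nu(0) + ... + nu(m),
    whence nu(m) <= Q^-m / omega(m,Q).  The cyclic ones have weight at least
    1 / (Q^m - Q^(m-1)), so the others have weight at most
    Q^-m (1/omega(m,Q) - 1/(1 - 1/Q)).

    Recursion.  Splitting off the primary component of some g bounds the weight of
    unc(n,q), times q^n, by W(n), where
    W(n) <= a2 W(n-2) + a (W(n-3) + ... + W(0)) and a2, a are explicit rational
    functions of q of order 1/q.  By induction W(n) <= A B^n for A = 1/q and
    B = 1 + 1/q + 2/q^2 when q >= 4, and for A = 1/2 and B = 1.59 when q = 3;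
    so only c*(q) > 1 is needed of c* in the second bound. *)
Require Import Defs.
From Stdlib Require Import Reals Lra Lia ClassicalEpsilon FunctionalExtensionality.
From Coquelicot Require Import Coquelicot.
Local Open Scope R_scope.

(** * Bounds for c* *)

Lemma nonneg_derive_nonneg (f f' : R -> R) (y : R) : 0 < y -> f 0 = 0 ->
  (forall x, 0 <= x <= y -> is_derive f x (f' x) /\ 0 <= f' x) -> 0 <= f y.
Proof.
intros y0 f0 df.
destruct (MVT_cor2 f f' 0 y y0) as [c [E cy]].
  now intros c cy; apply is_derive_Reals, df.
destruct (df c) as [_ H]; [lra|].
rewrite f0 in E; nra.
Qed.

Lemma ln_1m_upper (y : R) : 0 < y < 1 -> ln (1 - y) <= - y - y ^ 2 / 2.
Proof.
intros y01.
enough (0 <= - y - y ^ 2 / 2 - ln (1 - y)) by lra.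
apply (nonneg_derive_nonneg (fun y => - y - y ^ 2 / 2 - ln (1 - y)) (fun x => x ^ 2 / (1 - x))).
- lra.
- rewrite Rminus_0_r, ln_1; lra.
- intros x Hx; split.
  + auto_derive; [lra | field; lra].
  + apply Rdiv_le_0_compat; [nra | lra].
Qed.

(** The series tail from [y ^ 4] on is majorised by a geometric one with all denominators equal to
    4; the difference of the two sides then has the simple derivative
    [x ^ 4 / (4 * (1 - x) ^ 2)]. *)
Lemma ln_1m_lower (y : R) : 0 < y < 1 ->
  - ln (1 - y) <= y + y ^ 2 / 2 + y ^ 3 / 3 + y ^ 4 / (4 * (1 - y)).
Proof.
intros y01.
enough (0 <= y + y ^ 2 / 2 + y ^ 3 / 3 + y ^ 4 / (4 * (1 - y)) + ln (1 - y)) by lra.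
apply (nonneg_derive_nonneg
  (fun y => y + y ^ 2 / 2 + y ^ 3 / 3 + y ^ 4 / (4 * (1 - y)) + ln (1 - y))
  (fun x => x ^ 4 / (4 * (1 - x) ^ 2))).
- lra.
- rewrite Rminus_0_r, ln_1; field.
- intros x Hx; split.
  + auto_derive; [lra | field; lra].
  + apply Rdiv_le_0_compat; [apply pow_le; lra | nra].
Qed.

Lemma ln_ge_1_minus_inv (x : R) : 0 < x -> 1 - / x <= ln x.
Proof.
intros x0; assert (ix := Rinv_0_lt_compat _ x0).
assert (H : ln (/ x) <= / x - 1).
  rewrite <- (ln_exp (/ x - 1)); apply ln_le; [easy|].
  generalize (exp_ineq1_le (/ x - 1)); lra.
rewrite ln_Rinv in H; lra.
Qed.

Lemma prodR_ext (f g : nat -> R) m : (forall i, f i = g i) -> prodR f m = prodR g m.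
Proof. intros fg; induction m as [|m IH]; simpl; [easy | now rewrite IH, fg]. Qed.

Lemma prodR_front (f : nat -> R) m : prodR f (S m) = f 1%nat * prodR (fun i => f (S i)) m.
Proof. induction m as [|m IH]; [simpl; ring|]; simpl in *; rewrite IH; ring. Qed.

(** * Products of 1 - y^(i+j) and their limits *)

Section Product.
Variables (y : R) (j : nat).
Hypothesis y01 : 0 < y < 1.

Let p := prodR (fun i => 1 - y ^ (i + j)).

(* The union bound: prod (1 - t_i) >= 1 - sum t_i, with the geometric sum evaluated. *)
Lemma prodR_union m : 0 <= p m <= 1 /\ 1 - y ^ (j + 1) * (1 - y ^ m) / (1 - y) <= p m.
Proof.
induction m as [|m [[IH1 IH2] IH3]].
  unfold p; simpl; split; [lra|]. unfold Rdiv; rewrite Rminus_diag; lra.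
assert (t0 : 0 < y ^ (S m + j)) by (apply pow_lt; lra).
assert (t1 : y ^ (S m + j) <= 1) by (rewrite <- (pow1 (S m + j)); apply pow_incr; lra).
change (p (S m)) with (p m * (1 - y ^ (S m + j))); split; [split; nra|].
replace (y ^ (j + 1) * (1 - y ^ S m) / (1 - y))
  with (y ^ (j + 1) * (1 - y ^ m) / (1 - y) + y ^ (S m + j)); [nra|].
rewrite !pow_add; simpl; field; lra.
Qed.

Lemma prodR_lower m : 1 - y ^ (j + 1) / (1 - y) <= p m.
Proof.
apply Rle_trans with (2 := proj2 (prodR_union m)).
assert (0 <= y ^ (j + 1) * y ^ m / (1 - y)).
  apply Rdiv_le_0_compat; [apply Rmult_le_pos; apply pow_le|]; lra.
unfold Rdiv in *; nra.
Qed.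

Lemma prodR_decreasing : Un_decreasing p.
Proof.
intros m; destruct (prodR_union m) as [[H _] _].
change (p (S m)) with (p m * (1 - y ^ (S m + j))).
assert (0 < y ^ (S m + j)) by (apply pow_lt; lra); nra.
Qed.

(** [Lim] is an [epsilon] choice and says nothing until convergence is known; here the partial
    products decrease and stay nonnegative. *)
Lemma prodR_Lim : Un_cv p (Defs.Lim p).
Proof.
unfold Defs.Lim; apply epsilon_spec.
destruct (decreasing_cv p prodR_decreasing) as [l Hl]; [|now exists l].
exists 0; intros x [m ->]; unfold opp_seq.
destruct (prodR_union m) as [[H _] _]; lra.
Qed.

Lemma prodR_Lim_le m : Defs.Lim p <= p m.
Proof. exact (decreasing_ineq p _ prodR_decreasing prodR_Lim m). Qed.

Lemma prodR_Lim_ge c : (forall m, c <= p m) -> c <= Defs.Lim p.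
Proof.
intros H; apply (@Rle_cv_lim (fun _ => c) p); [easy | | apply prodR_Lim].
intros e He; exists 0%nat; intros; rewrite Rdist_eq; lra.
Qed.

End Product.

Lemma Lim_ext (u v : nat -> R) : (forall m, u m = v m) -> Defs.Lim u = Defs.Lim v.
Proof.
intros uv; unfold Defs.Lim; f_equal.
apply functional_extensionality; intros l.
now replace u with v; [|apply functional_extensionality; intros].
Qed.

Lemma inv_lt1 Q : 1 < Q -> 0 < / Q < 1.
Proof.
intros HQ; split; [apply Rinv_0_lt_compat; lra|].
rewrite <- Rinv_1; apply Rinv_lt_contravar; lra.
Qed.

Lemma c0_infE Q : c0_inf Q = Q ^ 2 * (1 - Defs.Lim (prodR (fun i => 1 - (/ Q) ^ (i + 1)))).
Proof.
unfold c0_inf; do 2 f_equal; apply Lim_ext; intros m; apply prodR_ext; intros i.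
now rewrite pow_inv, Nat.add_1_r.
Qed.

Lemma omega_infE Q : omega_inf Q = Defs.Lim (prodR (fun i => 1 - (/ Q) ^ (i + 0))).
Proof.
unfold omega_inf; apply Lim_ext; intros m; apply prodR_ext; intros i.
now rewrite pow_inv, Nat.add_0_r.
Qed.

(** Two factors suffice: the limit lies below every partial product, and
    [1 - (1 - y ^ 2) * (1 - y ^ 3)] already exceeds [y ^ 2]. *)
Lemma c0_inf_gt1 Q : 1 < Q -> 1 < c0_inf Q.
Proof.
intros HQ; rewrite c0_infE; assert (y01 := inv_lt1 Q HQ).
assert (H := prodR_Lim_le (/ Q) 1 y01 2); simpl prodR in H; simpl plus in H.
assert (E : Q = / / Q) by now rewrite Rinv_inv.
set (l := Defs.Lim _) in *; set (y := / Q) in *; clearbody l y; subst Q.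
replace 1 with ((/ y) ^ 2 * y ^ 2) at 1 by (field; lra).
apply Rmult_lt_compat_l; [apply pow_lt, Rinv_0_lt_compat; lra|].
assert (0 < (1 - y ^ 2) * y ^ 3) by (apply Rmult_lt_0_compat; [nra | apply pow_lt; lra]).
simpl in *; lra.
Qed.

Lemma c0_inf_le Q : 1 < Q -> c0_inf Q <= / (1 - / Q).
Proof.
intros HQ; rewrite c0_infE; assert (y01 := inv_lt1 Q HQ).
assert (H := prodR_Lim_ge (/ Q) 1 y01 _ (prodR_lower (/ Q) 1 y01)).
assert (E : Q = / / Q) by now rewrite Rinv_inv.
set (l := Defs.Lim _) in *; set (y := / Q) in *; clearbody l y; subst Q.
replace (/ (1 - y)) with ((/ y) ^ 2 * (y ^ (1 + 1) / (1 - y))) by (simpl; field; lra).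
apply Rmult_le_compat_l; [apply pow_le, Rlt_le, Rinv_0_lt_compat; lra | lra].
Qed.

(** The plain union bound gives 1.5 at [Q = 3], which leaves too little room below 1.56; so the
    first two factors are kept exactly and the union bound is applied from [y ^ 4] on. *)
Lemma c0_inf_le_sharp Q (y := / Q) : 1 < Q ->
  c0_inf Q <= 1 + y - y ^ 3 + (1 - y ^ 2 - y ^ 3 + y ^ 5) * (y ^ 2 / (1 - y)).
Proof.
intros HQ; rewrite c0_infE; assert (y01 := inv_lt1 Q HQ).
assert (H : (1 - y ^ 2) * (1 - y ^ 3) * (1 - y ^ 4 / (1 - y)) <=
            Defs.Lim (prodR (fun i => 1 - (/ Q) ^ (i + 1)))).
  apply (prodR_Lim_ge (/ Q) 1 y01); intros m; fold y in y01 |- *.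
  apply Rle_trans with (prodR (fun i => 1 - y ^ (i + 1)) (S (S m))).
    rewrite !prodR_front.
    rewrite (prodR_ext _ (fun i => 1 - y ^ (i + 3)));
      [|intros i; do 2 f_equal; lia].
    rewrite <- Rmult_assoc; apply Rmult_le_compat_l; [|exact (prodR_lower y 3 y01 m)].
    assert (y ^ 2 <= 1) by (rewrite <- (pow1 2); apply pow_incr; lra).
    assert (y ^ 3 <= 1) by (rewrite <- (pow1 3); apply pow_incr; lra).
    apply Rmult_le_pos; simpl in *; lra.
  apply Rle_trans with (prodR (fun i => 1 - y ^ (i + 1)) (S m)); apply (prodR_decreasing y 1 y01).
assert (E : Q = / y) by now unfold y; rewrite Rinv_inv.
set (l := Defs.Lim _) in *; fold y in y01; clearbody l y; subst Q.
apply Rle_trans with ((/ y) ^ 2 * (1 - (1 - y ^ 2) * (1 - y ^ 3) * (1 - y ^ 4 / (1 - y)))).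
  apply Rmult_le_compat_l; [apply pow_le, Rlt_le, Rinv_0_lt_compat; lra | lra].
right; field; lra.
Qed.

Lemma omega_inf_ge Q : 1 < Q -> 1 - / Q / (1 - / Q) <= omega_inf Q.
Proof.
intros HQ; rewrite omega_infE; assert (y01 := inv_lt1 Q HQ).
generalize (prodR_Lim_ge (/ Q) 0 y01 _ (prodR_lower (/ Q) 0 y01)).
now rewrite pow_1.
Qed.

(** For [y <= 1/9], omega is at least [(1 - 2 * y) / (1 - y)], hence at least [7/9 / (1 - y)], and
    [1 / (1 - y)] cancels against the bound for c0. *)
Lemma c0_div_omega Q : 9 <= Q -> 0 <= c0_inf Q / omega_inf Q <= 9 / 7.
Proof.
intros HQ; assert (HQ1 : 1 < Q) by lra.
assert (y01 := inv_lt1 Q HQ1).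
assert (y9 : / Q <= / 9) by (apply Rinv_le_contravar; lra).
assert (c1 := c0_inf_gt1 Q HQ1); assert (c2 := c0_inf_le Q HQ1).
assert (o := omega_inf_ge Q HQ1).
set (y := / Q) in *; clearbody y.
assert (o2 : 7 / 9 / (1 - y) <= omega_inf Q).
  apply Rle_trans with (2 := o).
  replace (1 - y / (1 - y)) with ((1 - 2 * y) / (1 - y)) by (field; lra).
  apply Rmult_le_compat_r; [apply Rlt_le, Rinv_0_lt_compat |]; lra.
assert (i : 0 < / (1 - y)) by (apply Rinv_0_lt_compat; lra).
assert (o3 : 0 < omega_inf Q) by (unfold Rdiv in o2; lra).
split; [apply Rdiv_le_0_compat; lra|].
apply Rle_div_l; [easy|]; unfold Rdiv in *; lra.
Qed.

(** The linear terms of the two logarithms cancel, since [q * y ^ 2 = y]; what remains is about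
    [y ^ 2 / 2]. *)
Lemma log_term_bounds q (y := / q) : 3 <= q ->
  0 <= q * ln (1 - / q ^ 2) - ln (1 - / q) <= y ^ 2 / 2 - y ^ 3 / 6 + y ^ 4 / (4 * (1 - y)).
Proof.
intros Hq; assert (y01 := inv_lt1 q ltac:(lra)).
assert (y3 : / q <= / 3) by (apply Rinv_le_contravar; lra).
assert (E : q = / y) by now unfold y; rewrite Rinv_inv.
rewrite <- pow_inv; fold y in y01, y3 |- *; clearbody y; subst q.
assert (Y01 : 0 < y ^ 2 < 1) by nra.
assert (iy : 0 < / y) by (apply Rinv_0_lt_compat; lra).
assert (a := ln_1m_upper y y01); assert (b := ln_1m_lower y y01).
assert (c := ln_1m_upper (y ^ 2) Y01).
assert (d := ln_ge_1_minus_inv (1 - y ^ 2) ltac:(lra)).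
apply (Rmult_le_compat_l (/ y) _ _ (Rlt_le _ _ iy)) in c, d; split.
- replace (/ y * (1 - / (1 - y ^ 2))) with (- y / (1 - y ^ 2)) in d by (field; lra).
  assert (y / (1 - y ^ 2) <= y + y ^ 2 / 2); [|unfold Rdiv in *; lra].
  apply Rle_div_l; [lra|]; nra.
- replace (/ y * (- y ^ 2 - (y ^ 2) ^ 2 / 2)) with (- y - y ^ 3 / 2) in c by (field; lra).
  lra.
Qed.

Lemma cstar_bounds q : 3 <= q -> 1 < cstar q < 156 / 100.
Proof.
intros Hq; unfold cstar; assert (y01 := inv_lt1 q ltac:(lra)).
assert (y3 : / q <= / 3) by (apply Rinv_le_contravar; lra).
assert (c1 := c0_inf_gt1 q ltac:(lra)); assert (c2 := c0_inf_le_sharp q ltac:(lra)).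
assert (C := c0_div_omega (q ^ 2) ltac:(nra)); assert (L := log_term_bounds q Hq).
replace (omega_fin 4 q * c0_inf (q ^ 2) / omega_inf (q ^ 2))
  with (omega_fin 4 q * (c0_inf (q ^ 2) / omega_inf (q ^ 2))) by (unfold Rdiv; ring).
assert (w : 0 <= omega_fin 4 q <= (1 - / q) * (1 - (/ q) ^ 2) * (1 - (/ q) ^ 3)).
  unfold omega_fin, prodR; rewrite <- !pow_inv, pow_1, Rmult_1_l.
  set (y := / q) in *; clearbody y.
  assert (0 <= y ^ 4 <= 1) by (split; [apply pow_le | rewrite <- (pow1 4); apply pow_incr]; lra).
  assert (y ^ 2 <= 1) by (rewrite <- (pow1 2); apply pow_incr; lra).
  assert (y ^ 3 <= 1) by (rewrite <- (pow1 3); apply pow_incr; lra).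
  assert (0 <= (1 - y) * (1 - y ^ 2) * (1 - y ^ 3)) by (repeat apply Rmult_le_pos; lra).
  nra.
set (D := q * ln _ - _) in *; set (r := c0_inf _ / _) in *; set (om := omega_fin 4 q) in *.
set (y := / q) in *.
assert (E : q = / y) by now unfold y; rewrite Rinv_inv.
set (c := c0_inf q) in *; clearbody D r om c y; subst q.
assert (iy : 0 < / y) by (apply Rinv_0_lt_compat; lra).
split.
  assert (0 <= / y * (om * r) * D); [|lra].
  repeat apply Rmult_le_pos; lra.
set (w4 := (1 - y) * (1 - y ^ 2) * (1 - y ^ 3)) in *.
set (D1 := y ^ 2 / 2 - y ^ 3 / 6 + y ^ 4 / (4 * (1 - y))) in *.
assert (S : / y * (om * r) * D <= / y * (w4 * (9 / 7)) * D1).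
  apply Rmult_le_compat; try lra; [repeat apply Rmult_le_pos; lra|].
  apply Rmult_le_compat_l; [lra|]; apply Rmult_le_compat; lra.
apply Rle_lt_trans with (1 := Rplus_le_compat _ _ _ _ c2 S).
replace (/ y * (w4 * (9 / 7)) * D1) with
  (9 / 7 * (y * (1 - y ^ 2) * (1 - y ^ 3) * (1 / 2 - 2 / 3 * y + 5 / 12 * y ^ 2)))
  by (unfold w4, D1; field; lra).
assert (y2 : y ^ 2 / (1 - y) <= 3 / 2 * y ^ 2).
  apply Rle_div_l; [lra|]; nra.
clear - y01 y3 y2.
assert (y2b : 0 <= y ^ 2 <= 1 / 9) by nra.
assert (y3b : 0 <= y ^ 3 <= 1 / 27) by (simpl in *; nra).
set (u := 1 - y ^ 2 - y ^ 3 + y ^ 5).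
assert (u0 : 0 <= u).
  replace u with ((1 - y ^ 2) * (1 - y ^ 3)) by (unfold u; ring).
  apply Rmult_le_pos; lra.
(* The factor [9/7] is multiplied out and joined with the [3/2 * y ^ 2] of [y2]; in degree two,
   [-6/7 + 3/2 = 9/14]. *)
apply Rle_lt_trans with (1 + y - y ^ 3 +
  u * (9 / 14 * y + 9 / 14 * y ^ 2 + 15 / 28 * y ^ 3)).
  apply (Rmult_le_compat_l u) in y2; [|easy].
  replace (9 / 7 * (y * (1 - y ^ 2) * (1 - y ^ 3) * (1 / 2 - 2 / 3 * y + 5 / 12 * y ^ 2)))
    with (u * (9 / 7 * (y * (1 / 2 - 2 / 3 * y + 5 / 12 * y ^ 2)))) by (unfold u; ring).
  unfold Rdiv in *; nra.
(* The extreme case is [y = 1/3]: [8/27], [208/243] and [11/36] are the values there, while [u]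
   falls with slope at most 1 and [v] rises with slope at least [9/14]. *)
assert (h1 : y - y ^ 3 <= 8 / 27) by (simpl in *; nra).
assert (h2 : u <= 208 / 243 + (1 / 3 - y)).
  assert (y5 : y ^ 2 * y ^ 3 <= 1 / 9 * (1 / 27)) by (apply Rmult_le_compat; lra).
  assert (0 <= (1 / 3 - y) * (1 - (1 / 3 + y) - (1 / 9 + y / 3 + y ^ 2))).
    apply Rmult_le_pos; lra.
  unfold u; simpl in *; lra.
set (v := 9 / 14 * y + 9 / 14 * y ^ 2 + 15 / 28 * y ^ 3).
assert (h3 : 0 <= v <= 11 / 36 - 9 / 14 * (1 / 3 - y)) by (unfold v; lra).
assert (u * v <= (208 / 243 + (1 / 3 - y)) * (11 / 36 - 9 / 14 * (1 / 3 - y))).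
  apply Rmult_le_compat; lra.
nra.
Qed.

From mathcomp Require Import all_boot all_order all_algebra.
From mathcomp Require Import ring lra zify.
Set Implicit Arguments. Unset Strict Implicit. Unset Printing Implicit Defensive.
Import Order.TTheory GRing.Theory Num.Theory.
Local Open Scope ring_scope.

(** * Polynomials in a matrix, annihilators and Krylov matrices *)

Section MxEval.
Variable F : finFieldType.
Implicit Types p g : {poly F}.

Lemma mx_eval_horner (n : nat) p (X : 'M[F]_n.+1) : mx_eval p X = horner_mx X p.
Proof.
rewrite -{2}[p]coefK poly_def rmorph_sum; apply: eq_bigr => i _.
by rewrite [RHS]horner_mxZ rmorphXn /= horner_mx_X.
Qed.

Lemma mx_evalM (n : nat) p g (X : 'M[F]_n) :
  mx_eval (p * g) X = mx_eval p X *m mx_eval g X.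
Proof.
case: n X => [|n] X; first by apply/matrixP => -[].
by rewrite !mx_eval_horner rmorphM.
Qed.

Lemma mx_evalC (n : nat) p g (X : 'M[F]_n) :
  mx_eval p X *m mx_eval g X = mx_eval g X *m mx_eval p X.
Proof. by rewrite -!mx_evalM mulrC. Qed.

Lemma mx_evalD (n : nat) p g (X : 'M[F]_n) :
  mx_eval (p + g) X = mx_eval p X + mx_eval g X.
Proof.
case: n X => [|n] X; first by apply/matrixP => -[].
by rewrite !mx_eval_horner rmorphD.
Qed.

Lemma mx_evalZ (n : nat) a p (X : 'M[F]_n) : mx_eval (a *: p) X = a *: mx_eval p X.
Proof.
case: n X => [|n] X; first by apply/matrixP => -[].
by rewrite !mx_eval_horner horner_mxZ.
Qed.

Lemma mx_evalXn (n : nat) p k (X : 'M[F]_n) : mx_eval (p ^+ k) X = mx_eval p X ^+ k.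
Proof.
case: n X => [|n] X; first by apply/matrixP => -[].
by rewrite !mx_eval_horner rmorphXn.
Qed.

Lemma mx_eval1 (n : nat) (X : 'M[F]_n) : mx_eval 1 X = 1%:M.
Proof.
case: n X => [|n] X; first by apply/matrixP => -[].
by rewrite !mx_eval_horner rmorph1.
Qed.

Lemma mx_evalX (n : nat) (X : 'M[F]_n) : mx_eval 'X X = X.
Proof.
case: n X => [|n] X; first by apply/matrixP => -[].
by rewrite !mx_eval_horner horner_mx_X.
Qed.

Lemma mx_eval0 (n : nat) (X : 'M[F]_n) : mx_eval 0 X = 0.
Proof. by rewrite -(scale0r 0) mx_evalZ scale0r. Qed.

Lemma mxexprD (n : nat) (X : 'M[F]_n) i j : X ^+ (i + j) = X ^+ i *m X ^+ j.
Proof. exact: exprD. Qed.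

Lemma mxexprSr (n : nat) (X : 'M[F]_n) i : X ^+ i.+1 = X ^+ i *m X.
Proof. exact: exprSr. Qed.

(** [U *m X = Y *m U] says that the rows of [U] span an invariant subspace on which [X] acts by [Y];
    restrictions, quotients and conjugations are all handled through this identity. *)
Lemma mx_eval_intertwine (k n : nat) (U : 'M[F]_(k, n)) X Y p :
  U *m X = Y *m U -> U *m mx_eval p X = mx_eval p Y *m U.
Proof.
move=> UX; rewrite mulmx_sumr mulmx_suml; apply: eq_bigr => i _.
rewrite -scalemxAl -scalemxAr; congr (_ *: _).
elim: (i : nat) => [|j IH]; first by rewrite !expr0 mulmx1 mul1mx.
by rewrite mxexprSr mulmxA IH mxexprSr -!mulmxA UX.
Qed.

Lemma dvdp_mx_eval0 (n : nat) (v : 'rV[F]_n) X p g :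
  p %| g -> v *m mx_eval p X = 0 -> v *m mx_eval g X = 0.
Proof.
by move/dvdpP=> [h ->] vp; rewrite mulrC mx_evalM mulmxA vp mul0mx.
Qed.

Lemma gcdp_mx_eval0 (n : nat) (v : 'rV[F]_n) X p g :
  v *m mx_eval p X = 0 -> v *m mx_eval g X = 0 -> v *m mx_eval (gcdp p g) X = 0.
Proof.
move=> vp vg; have [[u w] /= /eqp_dvdl E] := Bezoutp p g.
apply: (@dvdp_mx_eval0 _ _ _ (u * p + w * g)); first by rewrite E.
by rewrite mx_evalD mulmxDr ![_ * p]mulrC ![_ * g]mulrC !mx_evalM !mulmxA vp vg !mul0mx addr0.
Qed.

Lemma coprimep_mx_eval0 (n : nat) (v : 'rV[F]_n) X p g : coprimep p g ->
  v *m mx_eval p X = 0 -> v *m mx_eval g X = 0 -> v = 0.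
Proof.
move=> cpg vp vg; rewrite -[v]mulmx1 -(mx_eval1 X).
apply: (dvdp_mx_eval0 _ (gcdp_mx_eval0 vp vg)).
by move: cpg; rewrite -gcdp_eqp1 => /eqp_dvdl ->; apply: dvdpp.
Qed.

Lemma irr_coprimep g p : irreducible_poly g -> ~~ (g %| p) -> coprimep g p.
Proof.
move=> irr gNp; rewrite /coprimep; have := dvdp_gcdl g p.
case: (eqVneq (size (gcdp g p)) 1) => [//|ne /(irr.2 _ ne) E].
by case/negP: gNp; rewrite -(eqp_dvdl _ E) dvdp_gcdr.
Qed.

Lemma dvdp_irr_exp g p N : irreducible_poly g -> p %| g ^+ N ->
  exists2 j, (j <= N)%N & p %= g ^+ j.
Proof.
move=> irr; elim: N p => [|N IH] p.
  by rewrite expr0 dvdp1 size_poly_eq1 => p1; exists 0; rewrite ?expr0.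
case: (boolP (g %| p)) => [/dvdpP [p' ->]|gNp pd].
  rewrite exprS mulrC dvdp_mul2l ?irredp_neq0// => /IH [j jN E].
  by exists j.+1; rewrite // exprS eqp_mull.
exists 0 => //; rewrite expr0 -size_poly_eq1.
have cgp : coprimep p (g ^+ N.+1).
  by rewrite coprimep_sym; apply: coprimep_expl; apply: irr_coprimep.
by move: cgp; rewrite /coprimep; move/dvdp_gcd_idl: pd => /eqp_size ->.
Qed.

(** For irreducible [g] this says that [g ^ j] generates the annihilator of [v]; phrasing it by the
    least exponent keeps it boolean, so that such pairs can be counted. *)
Definition min_ann (n : nat) g j (X : 'M[F]_n) (v : 'rV[F]_n) : bool :=
  (v *m mx_eval g X ^+ j == 0) && [forall i : 'I_j, v *m mx_eval g X ^+ i != 0].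

Lemma min_annP (n : nat) g N (X : 'M[F]_n) v : v *m mx_eval g X ^+ N = 0 ->
  exists2 j, (j <= N)%N & min_ann g j X v.
Proof.
move=> vN; have ex : exists i, v *m mx_eval g X ^+ i == 0 by exists N; apply/eqP.
case: (ex_minnP ex) => j vj jmin; exists j; first by apply: jmin; apply/eqP.
rewrite /min_ann vj; apply/forallP => i; apply/negP => /jmin.
by rewrite leqNgt ltn_ord.
Qed.

(** The gcd of [p] and [g ^ j] kills [v] and is a power of [g]; minimality of [j] makes it [g ^ j]
    itself. *)
Lemma min_ann_dvdp (n : nat) g j (X : 'M[F]_n) v p : irreducible_poly g ->
  min_ann g j X v -> v *m mx_eval p X = 0 -> g ^+ j %| p.
Proof.
move=> irr /andP[/eqP vj /forallP jmin] vp.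
have /(dvdp_irr_exp irr) [i ij E] : gcdp p (g ^+ j) %| g ^+ j by apply: dvdp_gcdr.
have vi : v *m mx_eval g X ^+ i = 0.
  rewrite -mx_evalXn; apply: (@dvdp_mx_eval0 _ _ _ (gcdp p (g ^+ j))).
    by rewrite (eqp_dvdl _ E) dvdpp.
  by apply: gcdp_mx_eval0 => //; rewrite mx_evalXn.
move: ij; rewrite leq_eqVlt => /orP[/eqP<-|ij].
  by rewrite -(eqp_dvdl _ E) dvdp_gcdl.
by have := jmin (Ordinal ij); rewrite /= vi eqxx.
Qed.

Definition krylov (k n : nat) (v : 'rV[F]_n) (X : 'M[F]_n) : 'M[F]_(k, n) :=
  \matrix_(i < k) (v *m X ^+ i).

Lemma mulmx_krylov (k n : nat) (u : 'rV[F]_k) (v : 'rV_n) X :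
  u *m krylov k v X = v *m mx_eval (rVpoly u) X.
Proof.
have -> : rVpoly u = \sum_(i < k) u 0 i *: 'X^i.
  rewrite /rVpoly poly_def; apply: eq_bigr => i _.
  by rewrite valK.
have -> : mx_eval (\sum_(i < k) u 0 i *: 'X^i) X = \sum_(i < k) u 0 i *: X ^+ i.
  elim/big_rec2: _ => [|i y z _ <-]; first exact: mx_eval0.
  by rewrite mx_evalD mx_evalZ mx_evalXn mx_evalX.
rewrite mulmx_sum_row mulmx_sumr; apply: eq_bigr => i _.
by rewrite rowK -scalemxAr.
Qed.

Lemma size_exp_monic g j : g \is monic -> size (g ^+ j) = ((size g).-1 * j).+1.
Proof.
move=> gm; rewrite -size_exp prednK// lt0n size_poly_eq0 expf_eq0.
by rewrite (negPf (monic_neq0 gm)) andbF.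
Qed.

(** A linear relation among the rows is a polynomial of degree below that of [g ^ j] which kills
    [v]; being a multiple of [g ^ j], it is zero. *)
Lemma krylov_free (n : nat) g j (X : 'M[F]_n) v : g \is monic -> irreducible_poly g ->
  min_ann g j X v -> row_free (krylov ((size g).-1 * j) v X).
Proof.
move=> gm irr mj; rewrite -kermx_eq0; apply/eqP/row_matrixP => i; rewrite row0.
set u := row i _.
have : u *m krylov ((size g).-1 * j) v X = 0 by apply/sub_kermxP; apply: row_sub.
rewrite mulmx_krylov => /(min_ann_dvdp irr mj) gd.
rewrite -[u]rVpolyK; case: (eqVneq (rVpoly u) 0) => [->|nz]; first by rewrite linear0.
have := dvdp_leq nz gd; rewrite size_exp_monic// => /leq_trans /(_ (size_poly _ _)).
by rewrite ltnn.
Qed.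

Lemma min_ann_dim (n : nat) g j (X : 'M[F]_n) v : g \is monic -> irreducible_poly g ->
  min_ann g j X v -> ((size g).-1 * j <= n)%N.
Proof. by move=> gm irr /(krylov_free gm irr)/eqP <-; apply: rank_leq_col. Qed.

Lemma min_ann_le (n : nat) g j (X : 'M[F]_n) v : g \is monic -> irreducible_poly g ->
  min_ann g j X v -> (j <= n)%N.
Proof.
move=> gm irr /(min_ann_dim gm irr); apply: leq_trans.
by apply: leq_pmull; have [] := irr; case: (size g) => [|[]].
Qed.

(** The least exponent never exceeds [n], so higher powers of [g(X)] do not enlarge the kernel. This
    allows kernels to be compared across matrices of different sizes. *)
Lemma mx_eval_exp_stable (n : nat) g N (X : 'M[F]_n) (v : 'rV_n) : g \is monic -> irreducible_poly g ->
  v *m mx_eval g X ^+ N = 0 -> v *m mx_eval g X ^+ n = 0.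
Proof.
move=> gm irr /min_annP [j _ mj]; have jn := min_ann_le gm irr mj.
case/andP: mj => /eqP vj _.
have -> : mx_eval g X ^+ n = mx_eval g X ^+ (j + (n - j)) by rewrite subnKC.
by rewrite mxexprD mulmxA vj mul0mx.
Qed.

End MxEval.

(** * Counting with invariant subspaces *)

Section BlockCount.
Variable F : finFieldType.

Definition GLset n : {set 'M[F]_n} := [set P | P \in unitmx].
Definition gl n : nat := #|GLset n|.

Lemma gl_gt0 n : (0 < gl n)%N.
Proof. by apply/card_gt0P; exists 1%:M; rewrite inE unitmx1. Qed.

Lemma gl_le n : (gl n <= #|F| ^ (n * n))%N.
Proof. by rewrite -card_mx max_card. Qed.

Lemma unitmx_lblock k l (a : 'M[F]_k) e (c : 'M_l) :
  (block_mx a 0 e c \in unitmx) = (a \in unitmx) && (c \in unitmx).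
Proof. by rewrite !unitmxE det_lblock unitrM. Qed.

(* The block triangular matrices G = block_mx a 0 e c with a in H act on the
   conjugating matrices P: the pair (i, G) is recovered from G P_i (via r) and the
   nonzero blocks of G P_i X_i (G P_i)^-1. *)
Lemma block_count k l (I : finType) (A : {set I}) (H T1 : {set 'M[F]_k}) (T2 : {set 'M[F]_l})
    (X : I -> 'M[F]_(k + l)) (r : 'M[F]_(k + l) -> 'M[F]_(k + l) -> I) :
  {subset H <= unitmx} ->
  (forall i, i \in A -> exists P Y B D,
    [/\ P \in unitmx, P *m X i = block_mx Y 0 B D *m P,
     forall a, a \in H -> a *m Y *m invmx a \in T1,
     forall c, c \in unitmx -> c *m D *m invmx c \in T2 &
     forall a e c, a \in H -> r (X i) (block_mx a 0 e c *m P) = i]) ->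
  (#|A| * #|H| * gl l <= gl (k + l) * #|T1| * #|T2|)%N.
Proof.
move=> Hu ex.
(* The witnesses become a function of [i], with zero matrices as default outside [A]. *)
have /fin_all_exists [w wP] : forall i, exists w : 'M[F]_(k + l) * 'M[F]_k * 'M[F]_(l, k) * 'M[F]_l,
  i \in A -> let: (P, Y, B, D) := w in
    [/\ P \in unitmx, P *m X i = block_mx Y 0 B D *m P,
     forall a, a \in H -> a *m Y *m invmx a \in T1,
     forall c, c \in unitmx -> c *m D *m invmx c \in T2 &
     forall a e c, a \in H -> r (X i) (block_mx a 0 e c *m P) = i].
  move=> i; case: (boolP (i \in A)) => [/ex [P [Y [B [D h]]]]|_].
    by exists (P, Y, B, D).
  by exists (0, 0, 0, 0).
(* The last entry is the lower left block of [G *m block_mx Y 0 B D *m invmx G]. *)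
pose f (t : I * 'M[F]_k * 'M[F]_l * 'M[F]_(l, k)) :=
  let: (i, a, c, e) := t in let: (P, Y, B, D) := w i in
  (block_mx a 0 e c *m P, a *m Y *m invmx a, c *m D *m invmx c,
   (e *m Y + c *m B - c *m D *m invmx c *m e) *m invmx a).
pose f' (t : 'M[F]_(k + l) * 'M[F]_k * 'M[F]_l * 'M[F]_(l, k)) :=
  let: (P', y, d, b) := t in
  let i := r (invmx P' *m block_mx y 0 b d *m P') P' in
  let: (P, Y, B, D) := w i in
  let G := P' *m invmx P in (i, ulsubmx G, drsubmx G, dlsubmx G).
set S := setX (setX (setX A H) (GLset l)) [set: 'M[F]_(l, k)].
set T := setX (setX (setX (GLset (k + l)) T1) T2) [set: 'M[F]_(l, k)].
have fI : {in S &, injective f}.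
  apply: (@can_in_inj _ _ _ _ f') => -[[[i a] c] e].
  rewrite !inE andbT /= => /andP[/andP[iA aH] cu]; rewrite /f'.
  have au := Hu _ aH.
  move: (wP i iA); case E : (w i) => [[[P Y] B] D] [Pu PX h1 h2 h3].
  set G := block_mx a 0 e c; have Gu : G \in unitmx by rewrite unitmx_lblock au.
  set T' := block_mx _ 0 _ _.
  have TG : T' *m G = G *m block_mx Y 0 B D.
    rewrite /T' /G !mulmx_block !mulmx0 !mul0mx !add0r !addr0.
    by rewrite !(mulmxKV au, mulmxKV cu) subrK.
  have XE : invmx (G *m P) *m T' *m (G *m P) = X i.
    have PGu : G *m P \in unitmx by rewrite unitmx_mul Gu.
    apply: (can_inj (mulKmx PGu)).
    by rewrite -[invmx _ *m _ *m _]mulmxA mulKVmx// mulmxA TG -!mulmxA PX.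
  rewrite XE h3// E mulmxK//.
  by rewrite /G block_mxKul block_mxKdr block_mxKdl.
have fS : f @: S \subset T.
  apply/subsetP => _ /imsetP [[[[i a] c] e] tS ->].
  move: tS; rewrite !inE andbT /= => /andP[/andP[iA aH] cu]; rewrite /f; move: (wP i iA); case E : (w i) => [[[P Y] B] D] [Pu PX h1 h2 h3].
  by rewrite /= unitmx_mul unitmx_lblock (Hu _ aH) cu Pu h1 // h2.
(* The lower left blocks range over all of ['M_(l, k)] on both sides, so their number cancels. *)
have := subset_leq_card fS; rewrite (card_in_imset fI) /S /T !cardsX leq_pmul2r//.
by apply/card_gt0P; exists 0.
Qed.

End BlockCount.

(** * Multiplication by the variable modulo a polynomial *)

Section Companion.
Variable F : finFieldType.
Implicit Types p f : {poly F}.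

Lemma row_free_complete k l (A : 'M[F]_(k, k + l)) : row_free A ->
  exists2 P, P \in unitmx & usubmx P = A.
Proof.
move/eqP=> rA; exists (block_mx (col_ebase A) 0 0 1%:M *m row_ebase A).
  by rewrite unitmx_mul unitmx_lblock col_ebase_unit unitmx1 row_ebase_unit.
rewrite block_mxEv mul_col_mx col_mxKu -[RHS]mulmx_ebase rA pid_mx_row.
by rewrite mul_mx_row mulmx1 mulmx0.
Qed.

(** With upper left block 1 the first [k] rows of [P] survive, so a vector encoded in them can be
    read back from the product. *)
Lemma usubmx_lblock1 k l n (e : 'M[F]_(l, k)) c (P : 'M_(k + l, n)) :
  usubmx (block_mx 1%:M 0 e c *m P) = usubmx P.
Proof.
rewrite -{1}[P]vsubmxK block_mxEv mul_col_mx col_mxKu mul_row_col.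
by rewrite mul1mx mul0mx addr0.
Qed.

Lemma modp_mx_eval n (v : 'rV[F]_n) X p f : v *m mx_eval p X = 0 ->
  v *m mx_eval (f %% p) X = v *m mx_eval f X.
Proof.
move=> vp; rewrite [in RHS](divp_eq f p) mx_evalD mulmxDr mulrC mx_evalM mulmxA vp.
by rewrite mul0mx add0r.
Qed.

(* Multiplication by 'X on F[X] / (p), in the basis of the monomials. *)
Definition mulX_mod k p : 'M[F]_k := \matrix_(i < k) poly_rV ('X^(i.+1) %% p).

Lemma krylov_mulX k n p (v : 'rV[F]_n) X : size p = k.+1 -> v *m mx_eval p X = 0 ->
  krylov k v X *m X = mulX_mod k p *m krylov k v X.
Proof.
move=> sp vp; apply/row_matrixP => i; rewrite !row_mul !rowK mulmx_krylov poly_rV_K.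
  by rewrite modp_mx_eval// mx_evalXn mx_evalX mxexprSr mulmxA.
by rewrite -ltnS -sp ltn_modp -size_poly_gt0 sp.
Qed.

Lemma rV1_krylov k n p (v : 'rV[F]_n) X : size p = k.+1 -> v *m mx_eval p X = 0 ->
  p \is monic -> poly_rV 1 *m krylov k v X = v.
Proof.
case: k => [|k] sp vp pm.
  (* For [k = 0] the monic [p] is 1, so [v] itself is zero. *)
  have p1 : p = 1 by move/eqP: sp pm => /size_poly1P [c _ ->] /monicP; rewrite lead_coefC => ->.
  by rewrite thinmx0 mul0mx -vp p1 mx_eval1 mulmx1.
by rewrite mulmx_krylov poly_rV_K ?size_poly1// mx_eval1 mulmx1.
Qed.

Lemma poly_rV_modD k p (a : F) f1 f2 :
  poly_rV ((a *: f1 + f2) %% p) = a *: poly_rV (f1 %% p) + poly_rV (f2 %% p) :> 'rV_k.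
Proof. by rewrite modpD modpZl linearD linearZ. Qed.

Lemma mulX_mod_mul k p (f : {poly F}) : size p = k.+1 ->
  poly_rV (f %% p) *m mulX_mod k p = poly_rV ((f * 'X) %% p).
Proof.
move=> sp; have pnz : p != 0 by rewrite -size_poly_gt0 sp.
rewrite [f * _]mulrC -modp_mul; set h := f %% p.
have sh : (size h <= k)%N by rewrite -ltnS -sp ltn_modp.
rewrite mulrC mulmx_sum_row; under eq_bigr do rewrite rowK.
rewrite -[in RHS](poly_rV_K sh) /rVpoly poly_def mulr_suml.
under [in RHS]eq_bigr do rewrite valK -scalerAl -exprSr.
by elim/big_rec2: _ => [|i y z _ ->]; rewrite ?mod0p ?linear0// modpD modpZl linearD linearZ.
Qed.

Lemma rV1_mulX_mod k p (f : {poly F}) : size p = k.+1 ->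
  poly_rV (1 %% p) *m mx_eval f (mulX_mod k p) = poly_rV (f %% p).
Proof.
move=> sp; have E i : poly_rV (1 %% p) *m mulX_mod k p ^+ i = poly_rV ('X^i %% p).
  elim: i => [|i IH]; first by rewrite !expr0 mulmx1.
  by rewrite mxexprSr mulmxA IH mulX_mod_mul// -exprSr.
rewrite {2}(_ : f = \sum_(i < size f) f`_i *: 'X^i); last by rewrite -poly_def coefK.
rewrite mulmx_sumr; elim/big_rec2: _ => [|i y z _ ->]; first by rewrite mod0p linear0.
by rewrite poly_rV_modD -E scalemxAr.
Qed.

(** Each basis vector is ['X^i] applied to the class of 1, and polynomials in the matrix commute, so
    it is enough that [p] kills that class. *)
Lemma mulX_mod_root k p : size p = k.+1 -> mx_eval p (mulX_mod k p) = 0.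
Proof.
move=> sp; apply/row_matrixP => i; rewrite row0 rowE.
have -> : delta_mx 0 i = poly_rV (1 %% p) *m mx_eval 'X^i (mulX_mod k p).
  rewrite rV1_mulX_mod// -rVpoly_delta modp_small ?rVpolyK//.
  by rewrite sp ltnS size_poly.
by rewrite -mulmxA mx_evalC mulmxA rV1_mulX_mod// modpp linear0 mul0mx.
Qed.

End Companion.

(** * Primary matrices *)

(* om (1 / Q) m is omega(m,Q). *)
Definition om (K : fieldType) (z : K) m := \prod_(i < m) (1 - z ^+ i.+1).

Lemma omS (K : fieldType) (z : K) m : om z m.+1 = om z m * (1 - z ^+ m.+1).
Proof. by rewrite /om big_ord_recr. Qed.

Lemma om_neq0 (K : fieldType) (z : K) m : (forall i, z ^+ i.+1 != 1) -> om z m != 0.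
Proof. by move=> z1; apply/prodf_neq0 => i _; rewrite subr_eq0 eq_sym. Qed.

Lemma om_gt0 (K : realFieldType) (z : K) m : (forall i, z ^+ i.+1 < 1) -> 0 < om z m.
Proof. by move=> z1; apply: prodr_gt0 => i _; rewrite subr_gt0. Qed.

Section Primary.
Variables (F : finFieldType) (g : {poly F}) (N : nat).
Hypotheses (gm : g \is monic) (irr : irreducible_poly g).
Local Notation d := (size g).-1.
Local Notation q := #|F|.

(** The exponent bound [N] is independent of the size [n], so that restrictions and quotients stay
    in the same family. *)
Definition prim n : {set 'M[F]_n} := [set X | mx_eval g X ^+ N == 0].

Definition prim_pairs j n : {set 'M[F]_n * 'rV[F]_n} :=
  [set Xv | (Xv.1 \in prim n) && min_ann g j Xv.1 Xv.2].

Lemma irr_deg_gt0 : (0 < d)%N.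
Proof. by have [] := irr; case: (size g) => [|[]]. Qed.

Lemma prim_intertwine k n (U : 'M[F]_(k, n)) (X : 'M_n) (Y : 'M_k) : row_free U ->
  U *m X = Y *m U -> X \in prim n -> Y \in prim k.
Proof.
move=> /row_free_inj Ui UX; rewrite !inE => /eqP gX; apply/eqP; apply: Ui.
by rewrite mul0mx -mx_evalXn -(mx_eval_intertwine _ UX) mx_evalXn gX mulmx0.
Qed.

(** [D] is the action on the quotient by the span of the first [k] rows of [P]; [col_mx 0 1%:M] is
    the projection that intertwines it with the block matrix. *)
Lemma prim_lblock k l (X P : 'M[F]_(k + l)) Y B D : P \in unitmx ->
  P *m X = block_mx Y 0 B D *m P -> X \in prim (k + l) -> D \in prim l.
Proof.
move=> Pu PX; set T := block_mx _ _ _ _ in PX *.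
have TP : invmx P *m T = X *m invmx P.
  by apply: (can_inj (mulKmx Pu)); rewrite mulKVmx// mulmxA PX mulmxK.
have fP : row_free (invmx P) by rewrite row_free_unit unitmx_inv.
rewrite !inE => /eqP gX.
have gT : mx_eval g T ^+ N = 0.
  have Piu : invmx P \in unitmx by rewrite unitmx_inv.
  apply: (can_inj (mulKmx Piu)).
  by rewrite mulmx0 -mx_evalXn (mx_eval_intertwine _ TP) mx_evalXn gX mul0mx.
have TW : T *m col_mx 0 1%:M = col_mx 0 1%:M *m D.
  by rewrite /T mul_block_col mul_col_mx !mulmx0 !mul0mx mulmx1 mul1mx !add0r.
have := mx_eval_intertwine (g ^+ N) (esym TW).
rewrite !mx_evalXn gT mul0mx mul_col_mx mul0mx mul1mx => E.
by move: (congr1 dsubmx E); rewrite col_mxKd linear0 => ->.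
Qed.

(** On [F[X] v], in its Krylov basis, [X] acts by the fixed matrix [C]. Hence [H] and [T1] are
    singletons in [block_count], and [v] is recovered from the top rows of [P]. *)
Lemma prim_pairs_count j l :
  (#|prim_pairs j (d * j + l)| * gl F l <= gl F (d * j + l) * #|prim l|)%N.
Proof.
pose C := mulX_mod (d * j) (g ^+ j).
have := @block_count F (d * j) l _ (prim_pairs j (d * j + l)) [set 1%:M] [set C]
  (prim l) fst (fun X P => (X, poly_rV 1 *m usubmx P)).
rewrite !cards1 !muln1; apply.
  by move=> _ /set1P ->; apply: unitmx1.
move=> [X v]; rewrite inE /= => /andP[Xp mj].
have sg := size_exp_monic j gm; have [P Pu UP] := row_free_complete (krylov_free gm irr mj).
have vg : v *m mx_eval (g ^+ j) X = 0 by case/andP: mj => /eqP; rewrite mx_evalXn.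
set T := P *m X *m invmx P.
have PX : P *m X = block_mx C 0 (dlsubmx T) (drsubmx T) *m P.
  have TP : P *m X = T *m P by rewrite /T mulmxKV.
  rewrite TP; congr (_ *m _); rewrite -[LHS]submxK.
  have : usubmx T = row_mx C 0.
    have : usubmx P *m X = C *m usubmx P by rewrite UP; apply: krylov_mulX.
    rewrite mul_usub_mx TP -mul_usub_mx => E; rewrite -[usubmx T](mulmxK Pu) E.
    rewrite -mulmxA mul_usub_mx mulmxV// scalar_mx_block block_mxEv col_mxKu.
    by rewrite mul_mx_row mulmx1 mulmx0.
  by rewrite -[usubmx T]hsubmxK => /eq_row_mx [E1 E2]; rewrite /ulsubmx /ursubmx E1 E2.
exists P, C, (dlsubmx T), (drsubmx T); split => //.
- by move=> _ /set1P ->; rewrite mul1mx invmx1 mulmx1 set11.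
- move=> c cu; have Dp := prim_lblock Pu PX Xp.
  apply: (@prim_intertwine _ _ c) Dp; first by rewrite row_free_unit.
  by rewrite mulmxKV.
- move=> _ e c /set1P ->; rewrite usubmx_lblock1 UP (rV1_krylov (n := _) sg) //.
  exact: monic_exp.
Qed.


Lemma leq_card_bigcup (T I : finType) (P : pred I) (B : I -> {set T}) :
  (#|\bigcup_(i | P i) B i| <= \sum_(i | P i) #|B i|)%N.
Proof.
elim/big_rec2: _ => [|i m A _ IH]; first by rewrite cards0.
by rewrite (leq_trans (leq_card_setU _ _))// leq_add2l.
Qed.

(** Each [v] is killed by a least power [g ^ j], and [d * j <= d * M + r] with [r < d] forces
    [j <= M]. *)
Lemma prim_pairs_sum M r : (r < d)%N ->
  (#|prim (d * M + r)| * q ^ (d * M + r) <= \sum_(j < M.+1) #|prim_pairs j (d * M + r)|)%N.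
Proof.
move=> rd; set n := (_ + _)%N; rewrite -[X in (_ ^ X)%N]mul1n -card_mx -cardsT -cardsX.
apply: leq_trans (leq_card_bigcup _ _); apply: subset_leq_card; apply/subsetP => -[X v].
rewrite !inE andbT /= => Xp; move/eqP: (Xp) => Xp0.
have [|j _ mj] := @min_annP _ n g N X v; first by rewrite Xp0 mulmx0.
have jM : (j < M.+1)%N.
  have := min_ann_dim gm irr mj; rewrite /n; have := irr_deg_gt0; clear -rd; nia.
by apply/bigcupP; exists (Ordinal jM) => //; rewrite !inE Xp.
Qed.

Variable K : realFieldType.
Local Notation "m %:K" := (m%:R : K) (at level 2, left associativity, format "m %:K").

Definition nu n : K := #|prim n|%:R / (gl F n)%:R.

Lemma glK_gt0 n : 0 < (gl F n)%:K.
Proof. by rewrite ltr0n gl_gt0. Qed.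

Lemma nu_ge0 n : 0 <= nu n.
Proof. by rewrite divr_ge0. Qed.

Lemma nu_rec M r : (r < d)%N ->
  nu (d * M + r) * q%:K ^+ (d * M + r) <= \sum_(i < M.+1) nu (d * i + r).
Proof.
move=> rd; rewrite /nu mulrAC ler_pdivrMr ?glK_gt0// -natrX -natrM.
apply: le_trans (_ : (\sum_(j < M.+1) #|prim_pairs j (d * M + r)|)%:K <= _).
  by rewrite ler_nat prim_pairs_sum.
(* The sum is reversed because the quotient by [F[X] v] has size [d * (M - j) + r]. *)
rewrite natr_sum (reindex_inj rev_ord_inj) /= mulr_suml ler_sum// => i _.
rewrite mulrAC ler_pdivlMr ?glK_gt0// -!natrM ler_nat subSS [leqRHS]mulnC.
have e : (d * M + r = d * (M - i) + (d * i + r))%N.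
  by rewrite addnA -mulnDr subnK// -ltnS.
by move: (d * M + r)%N e => n ->; apply: prim_pairs_count.
Qed.


(** For [i > 0] the term is the difference of consecutive values of [1 / om]. This solves the
    recursion [nu_rec]. *)
Lemma om_telescope (z : K) m : (forall i, z ^+ i.+1 != 1) ->
  \sum_(i < m.+1) z ^+ i / om z i = (om z m)^-1.
Proof.
move=> z1; elim: m => [|m IH].
  by rewrite big_ord_recr big_ord0 /= add0r expr0 /om big_ord0 invr1 mulr1.
rewrite big_ord_recr /= IH omS.
have h := z1 m; have om0 := om_neq0 m z1.
have h' : 1 - z ^+ m.+1 != 0 by rewrite subr_eq0 eq_sym.
by field; rewrite om0 h'.
Qed.

Let y : K := q%:K^-1.

Lemma card_F_gt1 : (1 < q)%N.
Proof. by rewrite (cardD1 0) (cardD1 1) !inE oner_eq0. Qed.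

Lemma yX_lt1 i : (y ^+ i.+1 < 1).
Proof.
have q0 : 0 < q%:K by rewrite ltr0n (ltn_trans _ card_F_gt1).
by rewrite exprn_ilt1// /y ?invr_ge0 ?ltW// invf_lt1// ltr1n card_F_gt1.
Qed.

(** In [nu_rec] all terms below [M] vanish by induction, leaving [nu] times a power of [q] above 1
    at most [nu]. *)
Lemma nu_non_dvd M r : (0 < r < d)%N -> nu (d * M + r) = 0.
Proof.
case/andP=> r0 rd; elim/ltn_ind: M => M IH.
have := nu_rec M rd; rewrite big_ord_recr /= big1 => [|i _]; last exact: IH.
rewrite add0r -subr_le0 -[X in _ - X]mulr1 -mulrBr pmulr_lle0.
  by move=> h; apply/eqP; rewrite eq_le h nu_ge0.
by rewrite subr_gt0 exprn_egt1 ?ltr1n ?card_F_gt1// addn_eq0 negb_and -!lt0n r0 orbT.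
Qed.

(** The top term of the sum in [nu_rec] moves to the left; the others are bounded by induction and
    telescope to [1 / om z M]. *)
Lemma nu_dvd M : nu (d * M) <= y ^+ (d * M) / om (y ^+ d) M.
Proof.
have d0 := irr_deg_gt0; set z := y ^+ d.
have zlt1 i : z ^+ i.+1 < 1.
  by rewrite /z -exprM -[(d * _)%N]prednK ?muln_gt0 ?d0// yX_lt1.
have z1 i : z ^+ i.+1 != 1 by rewrite lt_eqF.
elim/ltn_ind: M => -[|M] IH.
  rewrite muln0 expr0 /om big_ord0 divr1 ler_pdivrMr ?glK_gt0// mul1r ler_nat.
  apply: leq_trans (gl_gt0 F 0); rewrite (leq_trans (max_card _))//.
  by rewrite card_mx.
have := @nu_rec M.+1 0 d0; rewrite !addn0 big_ord_recr /= addn0.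
under eq_bigr do rewrite addn0.
set S := \sum_(i < _) _ => h.
have {}h : nu (d * M.+1) * (q%:K ^+ (d * M.+1) - 1) <= (om z M)^-1.
  rewrite mulrBr mulr1 lerBlDr; apply: le_trans h _; rewrite lerD2r -om_telescope//.
  apply: ler_sum => i _; apply: le_trans (IH _ _) _ => //.
  by rewrite /z -exprM.
have zE : z ^+ M.+1 = (q%:K ^+ (d * M.+1))^-1 by rewrite /z -exprM exprVn.
rewrite omS /z -exprM -/z in zE *.
rewrite [y ^+ _]zE.
have Q1 : 1 < q%:K ^+ (d * M.+1).
  by rewrite exprn_egt1 ?ltr1n ?card_F_gt1// muln_eq0 negb_or -!lt0n d0.
set Q := q%:K ^+ _ in h Q1 *.
have omp : 0 < om z M by apply: om_gt0.
rewrite -(ler_pM2r (_ : 0 < Q - 1)) ?subr_gt0//.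
apply: le_trans h _; rewrite le_eqVlt; apply/orP; left; apply/eqP.
have Q0 : Q != 0 by rewrite gt_eqF// (lt_trans _ Q1).
have Q10 : Q - 1 != 0 by rewrite gt_eqF// subr_gt0.
by field; rewrite Q0 (gt_eqF omp) Q10.
Qed.

(** * Cyclic and noncyclic primary matrices *)

Definition ncyc n : {set 'M[F]_n} := [set X in prim n | ~~ asbool (cyclic_mod X 1%:M)].
Definition cyc n : {set 'M[F]_n} := [set X in prim n | asbool (cyclic_mod X 1%:M)].

Lemma asboolP P : reflect P (asbool P).
Proof. by rewrite /asbool; case: excluded_middle_informative => h; constructor. Qed.

Lemma min_ann_cyclic m (X : 'M[F]_(d * m)) v : min_ann g m X v -> cyclic_mod X 1%:M.
Proof.
move=> mv; exists v; first exact: submx1.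
move=> w _; have := krylov_free gm irr mv; rewrite row_free_unit => Ku.
exists (rVpoly (w *m invmx (krylov (d * m) v X))).
by rewrite -mulmx_krylov mulmxKV.
Qed.

(** Given one such vector [v0], the [v0 g(X) f(X)] with [f] of degree below [d * m] are
    [q ^ (d * m)] distinct vectors; all are killed by [g ^ m], so none of them counts. *)
Lemma card_min_ann m (X : 'M[F]_(d * m.+1)) :
  (#|[set v | min_ann g m.+1 X v]| <= q ^ (d * m.+1) - q ^ (d * m))%N.
Proof.
case: (set_0Vmem [set v | min_ann g m.+1 X v]) => [->|[v0]]; first by rewrite cards0.
rewrite inE => mv0.
rewrite leq_subRL; last by rewrite leq_exp2l ?card_F_gt1// leq_mul2l leqnSn orbT.
have vg : v0 *m mx_eval (g ^+ m.+1) X = 0 by case/andP: mv0 => /eqP; rewrite mx_evalXn.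
pose h (u : 'rV[F]_(d * m)) := v0 *m mx_eval (g * rVpoly u) X.
have hD u w : h (u - w) = h u - h w.
  rewrite /h; have -> : g * rVpoly (u - w) = g * rVpoly u + -1 *: (g * rVpoly w).
    by rewrite linearB mulrBr scaleN1r.
  by rewrite mx_evalD mx_evalZ scaleN1r mulmxDr mulmxN.
have hi : injective h.
  move=> u w huw; apply/eqP; rewrite -subr_eq0 -[_ - _]rVpolyK; apply/eqP.
  have : h (u - w) = 0 by rewrite hD huw subrr.
  move/(min_ann_dvdp irr mv0); rewrite exprS dvdp_mul2l ?irredp_neq0// => gd.
  case: (eqVneq (rVpoly (u - w)) 0) => [->|nz]; first by rewrite linear0.
  have := dvdp_leq nz gd; rewrite size_exp_monic// => /leq_trans /(_ (size_poly _ _)).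
  by rewrite ltnn.
have <- : #|h @: [set: 'rV_(d * m)]| = (q ^ (d * m))%N.
  by rewrite card_imset// cardsT card_mx mul1n.
have <- : #|{: 'rV[F]_(d * m.+1)}| = (q ^ (d * m.+1))%N by rewrite card_mx mul1n.
rewrite -cardsUI [X in (_ + X)%N](_ : _ = 0%N) ?addn0 ?max_card//.
apply/eqP; rewrite cards_eq0 -subset0; apply/subsetP => v; rewrite !inE.
case/andP=> /imsetP[u _ ->] /andP[_ /forallP /(_ ord_max)] /=; apply: contraNT => _.
by rewrite -mx_evalXn /h -mulmxA -mx_evalM mulrAC -exprS mx_evalM mulmxA vg mul0mx.
Qed.

(** [P] is sent to the pair of [P^-1 C P] and [e P], where [e] is the class of 1. This is injective,
    as [P] is the Krylov matrix of its image, and [card_min_ann] bounds the vectors lying over each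
    cyclic matrix. *)
Lemma gl_cyc_count m : (0 < m <= N)%N ->
  (gl F (d * m) <= #|cyc (d * m)| * (q ^ (d * m) - q ^ (d * m.-1)))%N.
Proof.
case: m => // m /= mN; set n := (d * m.+1)%N.
pose C := mulX_mod n (g ^+ m.+1); pose e : 'rV[F]_n := poly_rV (1 %% g ^+ m.+1).
have sg : size (g ^+ m.+1) = n.+1 by apply: size_exp_monic.
pose f (P : 'M[F]_n) := (invmx P *m C *m P, e *m P).
have PX P p : P \in unitmx -> P *m mx_eval p (f P).1 = mx_eval p C *m P.
  by move=> Pu; apply: mx_eval_intertwine; rewrite /f /= -!mulmxA mulKVmx.
have eX P p : P \in unitmx -> (f P).2 *m mx_eval p (f P).1 = poly_rV (p %% g ^+ m.+1) *m P.
  by move=> Pu; rewrite -mulmxA PX// mulmxA rV1_mulX_mod.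
have kP P : P \in unitmx -> krylov n (f P).2 (f P).1 = P.
  move=> Pu; apply/row_matrixP => i; rewrite rowK rowE.
  rewrite -[X in X ^+ i]mx_evalX -mx_evalXn eX// -rVpoly_delta modp_small ?rVpolyK//.
  by rewrite sg ltnS size_poly.
have fi : {in GLset F n &, injective f}.
  by move=> P P'; rewrite !inE => Pu Pu' E; rewrite -(kP P Pu) E kP.
pose S := [set Xv | (Xv.1 \in cyc n) && min_ann g m.+1 Xv.1 Xv.2] : {set 'M[F]_n * 'rV[F]_n}.
apply: (@leq_trans #|S|).
  rewrite /gl -(card_in_imset fi); apply: subset_leq_card.
  apply/subsetP => _ /imsetP[P PG ->]; have Pu : P \in unitmx by rewrite inE in PG.
  have mP : min_ann g m.+1 (f P).1 (f P).2.
    apply/andP; split; first by rewrite -mx_evalXn eX// modpp linear0 mul0mx.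
    apply/forallP => i; rewrite -mx_evalXn eX// -[0](mul0mx _ P) (can_eq (mulmxK Pu)).
    rewrite -(can_eq rVpolyK) linear0 poly_rV_K; last first.
      by rewrite -ltnS -sg ltn_modp -size_poly_gt0 sg.
    rewrite modp_small ?expf_neq0 ?irredp_neq0// !size_exp_monic// ltnS.
    by rewrite ltn_pmul2l ?irr_deg_gt0.
  rewrite !inE mP andbT; apply/andP; split; last by apply/asboolP; exact: min_ann_cyclic mP.
  have Pg := PX P (g ^+ N) Pu.
  rewrite -mx_evalXn -(can_eq (mulKmx Pu)) mulmx0 Pg -(subnK mN) exprD mx_evalM.
  by rewrite mulX_mod_root// mulmx0 mul0mx.
rewrite -sum1_card (eq_bigl (fun Xv => (Xv.1 \in cyc n) && min_ann g m.+1 Xv.1 Xv.2)); last first.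
  by move=> Xv; rewrite inE.
rewrite -(pair_big_dep (fun X => X \in cyc n) (fun X v => min_ann g m.+1 X v) (fun _ _ => 1%N)) /=.
rewrite -sum_nat_const; apply: leq_sum => X _.
by rewrite sum1dep_card card_min_ann.
Qed.

Definition eta n : K := #|ncyc n|%:R / (gl F n)%:R.

Lemma eta_ge0 n : 0 <= eta n.
Proof. by rewrite divr_ge0. Qed.

Lemma nu_split n : nu n = #|cyc n|%:R / (gl F n)%:R + eta n.
Proof.
rewrite -mulrDl -natrD; congr (_%:R / _).
rewrite -(cardsID (cyc n) (prim n)); congr (_ + _)%N; apply: eq_card => X; rewrite !inE.
  by rewrite andbA andbb.
by case: (mx_eval g X ^+ N == 0); case: (asbool _).
Qed.

Lemma eta0 : eta 0 = 0.
Proof.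
rewrite /eta (_ : ncyc 0 = set0) ?cards0 ?mul0r//; apply/setP => X; rewrite !inE.
apply/negP => /andP[_ /negP]; apply; apply/asboolP.
by exists 0 => [|w _]; [exact: sub0mx | exists 0; rewrite [w]thinmx0 mul0mx].
Qed.

Lemma eta_non_dvd M r : (0 < r < d)%N -> eta (d * M + r) = 0.
Proof.
move=> rd; apply/eqP; rewrite eq_le eta_ge0 andbT -(nu_non_dvd M rd) nu_split lerDr.
by rewrite divr_ge0.
Qed.

Lemma eta_dvd M : (0 < M <= N)%N ->
  eta (d * M) <= y ^+ (d * M) * ((om (y ^+ d) M)^-1 - (1 - y ^+ d)^-1).
Proof.
move=> MN; have := nu_dvd M; rewrite nu_split addrC -lerBrDr => /le_trans; apply.
rewrite mulrBr lerB// ler_pdivlMr ?glK_gt0//.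
have q0 : 0 < q%:K by rewrite ltr0n (ltn_trans _ card_F_gt1).
have := gl_cyc_count MN; rewrite -(ler_nat K) natrM natrB; last first.
  by rewrite leq_exp2l ?card_F_gt1// leq_mul2l leq_pred orbT.
rewrite !natrX; case: M MN => // M _ /=.
have -> : q%:K ^+ (d * M.+1) - q%:K ^+ (d * M) = q%:K ^+ (d * M.+1) * (1 - y ^+ d).
  rewrite mulrBr mulr1 exprVn mulnS exprD mulrAC divff ?mul1r// expf_neq0// gt_eqF//.
have d0 := irr_deg_gt0.
have y1 : 0 < 1 - y ^+ d by rewrite subr_gt0 -(prednK d0) yX_lt1.
have Q0 : 0 < q%:K ^+ (d * M.+1) by rewrite exprn_gt0.
have yE : y ^+ (d * M.+1) = (q%:K ^+ (d * M.+1))^-1 by apply: exprVn.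
move=> h; rewrite yE -invfM mulrC ler_pdivrMr ?mulr_gt0//.
Qed.

End Primary.

(** * Splitting off a primary component *)

Section Unc.
Variable F : finFieldType.
Implicit Types g p : {poly F}.

Lemma irr_monic_coprimep g p : g \is monic -> p \is monic ->
  irreducible_poly g -> irreducible_poly p -> g != p -> coprimep g p.
Proof.
move=> gm pm ig ip; apply: contraR => /(contraR (irr_coprimep ig)) gp.
rewrite -(eqp_monic gm pm); apply: ip.2 => //.
by have [+ _] := ig; case: (size g) => [|[]].
Qed.

Lemma Vg_subP n (X : 'M[F]_n) g (w : 'rV_n) :
  reflect (w *m mx_eval g X ^+ n = 0) (w <= Vg X g)%MS.
Proof. exact: sub_kermxP. Qed.

(* Implied by [uncyclic] (Cayley-Hamilton); unlike divisibility of the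
   characteristic polynomial, the condition Vg X g != 0 passes directly between
   X and its restriction to a summand. *)
Definition unc_weak n (X : 'M[F]_n) : Prop := forall g, g \is monic ->
  irreducible_poly g -> Vg X g != 0 -> ~ cyclic_mod X (Vg X g).

Lemma uncyclic_weak n (X : 'M[F]_n) : uncyclic X -> unc_weak X.
Proof.
move=> uX g gm irr gX; apply: uX => //; apply: contraNT gX => /(irr_coprimep irr) cg.
apply/eqP/row_matrixP => i; rewrite row0; move: (row i _) (row_sub i (Vg X g)) => v /Vg_subP vg.
apply: (coprimep_mx_eval0 (coprimep_expl n cg)); first by rewrite mx_evalXn; apply: vg.
clear cg; case: n X v vg {i} => [|n] X v _; first by rewrite [LHS]thinmx0.
by rewrite mx_eval_horner Cayley_Hamilton mulmx0.
Qed.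

Lemma cyclic_transfer k n (U : 'M[F]_(k, n)) X Y (W : 'M_n) (W' : 'M_k) :
  U *m X = Y *m U ->
  (forall w : 'rV_n, (w <= W)%MS -> exists2 w' : 'rV_k, (w' <= W')%MS & w = w' *m U) ->
  (forall w' : 'rV_k, (w' <= W')%MS -> (w' *m U <= W)%MS) ->
  cyclic_mod Y W' -> cyclic_mod X W.
Proof.
move=> UX lift desc [v vW vgen]; exists (v *m U); first exact: desc.
move=> w /lift [w' /vgen [p ->] ->]; exists p.
by rewrite -!mulmxA (mx_eval_intertwine _ UX).
Qed.

Section Transfer.
Variables (k n : nat) (U : 'M[F]_(k, n)) (X : 'M[F]_n) (Y : 'M[F]_k) (g : {poly F}).
Hypotheses (Uf : row_free U) (UX : U *m X = Y *m U).
Hypotheses (gm : g \is monic) (irr : irreducible_poly g).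

(** [Vg] uses exponent [k] for [Y] and [n] for [X]; [mx_eval_exp_stable] exchanges the two. *)
Lemma Vg_transfer (w : 'rV_k) : (w *m U <= Vg X g)%MS = (w <= Vg Y g)%MS.
Proof.
have E N : (w *m U *m mx_eval g X ^+ N == 0) = (w *m mx_eval g Y ^+ N == 0).
  rewrite -!mx_evalXn -mulmxA (mx_eval_intertwine _ UX) mulmxA.
  by rewrite -{1}[0](mul0mx _ U) (inj_eq (row_free_inj Uf)).
apply/Vg_subP/Vg_subP => /eqP.
  by rewrite E => /eqP; apply: mx_eval_exp_stable.
by rewrite -E => /eqP; apply: mx_eval_exp_stable.
Qed.

Lemma Vg_neq0_transfer : Vg Y g != 0 -> Vg X g != 0.
Proof.
case/rowV0Pn => w; rewrite -Vg_transfer => wX wn; apply/rowV0Pn; exists (w *m U) => //.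
by rewrite -[0](mul0mx _ U) (inj_eq (row_free_inj Uf)).
Qed.

(** The lifting hypothesis places all of [Vg X g] in the row space of [U], so the image of a
    generator generates. *)
Lemma cyclic_Vg_transfer :
  (forall w : 'rV_n, w *m mx_eval g X ^+ n = 0 -> exists w' : 'rV_k, w = w' *m U) ->
  cyclic_mod Y (Vg Y g) -> cyclic_mod X (Vg X g).
Proof.
move=> lift; apply: (cyclic_transfer UX) => w; last by rewrite Vg_transfer.
move=> wX; have /Vg_subP/lift [w' E] := wX.
by exists w' => //; rewrite -Vg_transfer -E.
Qed.

End Transfer.

Definition uset n : {set 'M[F]_n} := [set X | asbool (unc_weak X)].

Lemma conj_intertwine k (a Y : 'M[F]_k) : a \in unitmx ->
  a *m Y = (a *m Y *m invmx a) *m a.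
Proof. by move=> au; rewrite mulmxKV. Qed.

Lemma uset_conj l (c Z : 'M[F]_l) : c \in unitmx -> Z \in uset l ->
  c *m Z *m invmx c \in uset l.
Proof.
move=> cu; rewrite !inE => /asboolP uZ; apply/asboolP => g gm irr gY cY.
have cf : row_free c by rewrite row_free_unit.
have E := conj_intertwine Z cu.
apply: (uZ g gm irr (Vg_neq0_transfer cf E gm irr gY)).
apply: (cyclic_Vg_transfer cf E gm irr _ cY) => w _.
by exists (w *m invmx c); rewrite mulmxKV.
Qed.

Lemma in_ncyc g N k (Y : 'M[F]_k) :
  (Y \in ncyc g N k) = (Y \in prim g N k) && ~~ asbool (cyclic_mod Y 1%:M).
Proof. by rewrite inE. Qed.

Lemma ncyc_conj g N k (a Y : 'M[F]_k) : a \in unitmx -> Y \in ncyc g N k ->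
  a *m Y *m invmx a \in ncyc g N k.
Proof.
move=> au; rewrite in_ncyc => /andP[pY /asboolP nY].
have af : row_free a by rewrite row_free_unit.
have E := conj_intertwine Y au.
rewrite in_ncyc (prim_intertwine af E pY); apply/asboolP => cY; apply: nY.
apply: (cyclic_transfer E) cY => w _; last exact: submx1.
by exists (w *m invmx a); rewrite ?submx1// mulmxKV.
Qed.

Definition uset_at g (k n : nat) : {set 'M[F]_n} :=
  [set X in uset n | (Vg X g != 0) && (\rank (Vg X g) == k)].

Lemma rank_row_base (k n : nat) (A : 'M[F]_n) : \rank A = k ->
  exists2 U : 'M[F]_(k, n), row_free U & (U :=: A)%MS.
Proof. by move=> <-; exists (row_base A); [apply: row_base_free | apply: eq_row_base]. Qed.

(** Fitting decomposition: [G = g(X)^n] splits the space into its kernel, where [X] is primary and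
    noncyclic, and its image, where [X] is again [unc_weak]. The datum to recover is [X] itself, so
    [H] may be the whole of GL. *)
Lemma uset_at_count g (k l : nat) : g \is monic -> irreducible_poly g ->
  (#|uset_at g k (k + l)| * gl F k * gl F l <=
   gl F (k + l) * #|ncyc g (k + l) k| * #|uset l|)%N.
Proof.
move=> gm irr; set n := (k + l)%N.
apply: (@block_count F k l _ (uset_at g k n) (GLset F k) (ncyc g n k) (uset l) id (fun X _ => X)).
  by move=> a; rewrite inE.
move=> X; rewrite !inE => /andP[/asboolP uX /andP[gX /eqP rK]].
set G := mx_eval g X ^+ n.
have GX : G *m X = X *m G by have := mx_evalC (g ^+ n) 'X X; rewrite mx_evalX mx_evalXn.
have rG : \rank G = l.
  have := mxrank_ker G; rewrite -/(Vg X g) rK => E.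
  by have := rank_leq_row G; rewrite /n in E *; lia.
have [U1 U1f U1K] := rank_row_base rK; have [U2 U2f U2G] := rank_row_base rG.
have U1G : U1 *m G = 0 by apply/sub_kermxP; rewrite U1K.
(* Kernel and image of [G] meet in 0: [z G^2 = 0] implies [z G = 0] by stability of the exponent. *)
have dis (w : 'rV[F]_n) : w *m G = 0 -> (w <= U2)%MS -> w = 0.
  rewrite U2G => wG /submxP [z E]; rewrite E; move: wG; rewrite E -mulmxA => zG.
  apply: (@mx_eval_exp_stable F n g (n + n) X z gm irr); by rewrite mxexprD.
have [P Pu PE] : exists2 P, P \in unitmx & P = col_mx U1 U2.
  exists (col_mx U1 U2) => //; rewrite -row_free_unit /row_free -addsmxE.
  rewrite mxrank_disjoint_sum ?(eqP U1f) ?(eqP U2f)//.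
  apply/eqP/rowV0P => w; rewrite sub_capmx => /andP[w1 w2]; apply: dis => //.
  by case/submxP: w1 => z ->; rewrite -mulmxA U1G mulmx0.
have [Y YE] : exists Y, U1 *m X = Y *m U1.
  by apply/submxP; rewrite U1K; apply/sub_kermxP; rewrite -mulmxA -GX mulmxA U1G mul0mx.
have [Z ZE] : exists Z, U2 *m X = Z *m U2.
  apply/submxP; rewrite U2G; have /submxP [z ->] : (U2 <= G)%MS by rewrite U2G.
  by rewrite -mulmxA GX mulmxA submxMl.
have Yp : Y \in prim g n k.
  rewrite inE; apply/eqP; apply: (row_free_inj U1f).
  by rewrite mul0mx -mx_evalXn -(mx_eval_intertwine _ YE) mx_evalXn.
exists P, Y, 0, Z; split => //.
- by rewrite PE mul_col_mx mul_block_col !mul0mx addr0 add0r YE ZE.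
- move=> a; rewrite inE => au; apply: ncyc_conj => //.
  rewrite in_ncyc Yp; apply/asboolP => cY; apply: (uX g gm irr gX).
  apply: (cyclic_Vg_transfer U1f YE gm irr).
    by move=> w wG; apply/submxP; rewrite U1K; apply/sub_kermxP.
  case: cY => v _ vgen; exists v => [|w _]; last by apply: vgen; apply: submx1.
  rewrite -(Vg_transfer U1f YE gm irr); apply/Vg_subP.
  by rewrite -mulmxA U1G mulmx0.
- move=> c cu; apply: uset_conj => //; rewrite inE; apply/asboolP => g' gm' irr' gZ cZ.
  (* The image has no [g]-part. For [g' != g] the whole [g']-part lies in the image, since its
     component in the kernel is killed by coprime powers of [g] and [g']. *)
  case: (eqVneq g g') => [Eg|ne].
    subst g'; have /rowV0Pn [w wZ /negP] := gZ; apply; apply/eqP/(row_free_inj U2f).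
    rewrite mul0mx; apply: dis; last exact: submxMl.
    by apply/Vg_subP; rewrite (Vg_transfer U2f ZE gm irr).
  apply: (uX g' gm' irr' (Vg_neq0_transfer U2f ZE gm' irr' gZ)).
  apply: (cyclic_Vg_transfer U2f ZE gm' irr' _ cZ) => w wG.
  have [a [b wE]] : exists a b, w = a *m U1 + b *m U2.
    exists (lsubmx (w *m invmx P)), (rsubmx (w *m invmx P)).
    by rewrite -mul_row_col hsubmxK -PE mulmxKV.
  move: wG; rewrite wE mulmxDl -!mx_evalXn -!mulmxA (mx_eval_intertwine _ YE).
  rewrite (mx_eval_intertwine _ ZE) !mulmxA -mul_row_col -PE => /eqP.
  rewrite -{1}[0](mul0mx _ P) (can_eq (mulmxK Pu)) -row_mx0 => /eqP/eq_row_mx [aY _].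
  suff -> : a = 0 by exists b; rewrite mul0mx add0r.
  have cgg := irr_monic_coprimep gm gm' irr irr' ne.
  apply: (@coprimep_mx_eval0 _ _ a Y (g ^+ n) (g' ^+ n)) => //.
    by rewrite coprimep_expl// coprimep_expr.
  by move: Yp; rewrite inE mx_evalXn => /eqP ->; rewrite mulmx0.
Qed.

End Unc.

(** * Irreducible factors and their number *)

Section Irr.
Variable F : finFieldType.
Implicit Types g p : {poly F}.
Local Notation q := #|F|.

(** Starting from the characteristic polynomial and a basis vector, a reducible [p = l * h] is
    replaced by [l] if [l(X)] kills [v], and otherwise by [h], with [v l(X)] in place of [v]. *)
Lemma exists_irr_factor n (X : 'M[F]_n) : (0 < n)%N ->
  exists g, [/\ g \is monic, irreducible_poly g, Vg X g != 0 & (size g <= n.+1)%N].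
Proof.
move=> n0.
have [g [gm irr [v vn vg]]] : exists g, [/\ g \is monic, irreducible_poly g &
    exists2 v : 'rV_n, v != 0 & v *m mx_eval g X = 0].
  have red s p (v : 'rV_n) : (size p <= s)%N -> p != 0 -> v != 0 -> v *m mx_eval p X = 0 ->
      exists g, [/\ g \is monic, irreducible_poly g &
        exists2 v : 'rV_n, v != 0 & v *m mx_eval g X = 0].
    elim: s p v => [|s IH] p v sp pn vn vp.
      by move: sp; rewrite leqn0 size_poly_eq0 (negPf pn).
    case: (excluded_middle_informative (irreducible_poly p)) => [irr|nirr].
      have lp : (lead_coef p)^-1 != 0 by rewrite invr_eq0 lead_coef_eq0.
      exists ((lead_coef p)^-1 *: p); split.
      - by rewrite monicE lead_coefZ mulVf// lead_coef_eq0.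
      - have [p1 pd] := irr; split; first by rewrite size_scale.
        move=> h hn; rewrite (eqp_dvdr _ (eqp_scale p lp)) => /(pd _ hn) hp.
        by apply: eqp_trans hp _; rewrite eqp_sym eqp_scale.
      - by exists v => //; rewrite mx_evalZ -scalemxAr vp scaler0.
    have [h [hn hp hNp]] : exists h : {poly F}, [/\ size h != 1, h %| p & ~~ (h %= p)].
      case: (excluded_middle_informative (exists h : {poly F}, [/\ size h != 1, h %| p & ~~ (h %= p)])) => // nex.
      case: nirr; split.
        rewrite ltnNge leq_eqVlt ltnS leqn0 size_poly_eq0 (negPf pn) orbF.
        apply/negP => /size_poly1P [c c0 pc]; case/negP: vn; apply/eqP.
        move: vp; rewrite pc -[c%:P]mulr1 mul_polyC mx_evalZ mx_eval1 -scalemxAr mulmx1.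
        by move/eqP; rewrite scaler_eq0 (negPf c0) => /eqP.
      move=> h hn hp; case: (boolP (h %= p)) => // hNp; case: nex; by exists h.
    have [l pE] := dvdpP _ _ hp.
    have /andP[l0 h0] : (l != 0) && (h != 0) by rewrite -negb_or -mulf_eq0 -pE.
    have sh : (size h < size p)%N.
      by rewrite ltn_neqAle dvdp_leq// andbT (dvdp_size_eqp hp).
    case: (eqVneq (v *m mx_eval l X) 0) => [vl|vl].
      apply: (IH l v) => //; rewrite -ltnS; apply: leq_trans sp.
      rewrite pE size_mul//; move: hn h0; rewrite -size_poly_eq0.
      by case: (size h) => [|[|t]] // _ _; rewrite addnS /= addnS ltnS leq_addr.
    apply: (IH h (v *m mx_eval l X)) => //; first by rewrite -ltnS; apply: leq_trans sp.
    by rewrite -mulmxA -mx_evalM -pE.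
  case: n n0 X red => // n _ X red.
  apply: (red _ (char_poly X) (delta_mx 0 0) (leqnn _)).
  - by rewrite monic_neq0// char_poly_monic.
  - by apply/eqP => /matrixP /(_ 0 0); rewrite !mxE !eqxx => /eqP; rewrite oner_eq0.
  - by rewrite mx_eval_horner Cayley_Hamilton mulmx0.
exists g; split => //.
  apply/rowV0Pn; exists v => //; apply/Vg_subP.
  by case: n n0 X v {vn} vg => // n _ X v vg; rewrite exprS mulmxA vg mul0mx.
(* Exponent 0 is excluded by [v != 0]; exponent 1 bounds the degree of [g] by [n]. *)
have [|j _ mj] := @min_annP _ n g 1 X v; first by rewrite expr1.
have := min_ann_dim gm irr mj; case: j mj => [|j] mj.
  by case/andP: mj => /eqP; rewrite expr0 mulmx1 => E; rewrite E eqxx in vn.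
by have [+ _] := irr; rewrite mulnS; case: (size g) => [|s] //= _ /(leq_trans (leq_addr _ _)).
Qed.

(** Coding a monic polynomial of degree [d] by its lower coefficients turns the irreducible ones
    into a finite set. *)
Definition gpoly d (r : 'rV[F]_d) : {poly F} := 'X^d + rVpoly r.

Lemma size_gpoly d (r : 'rV[F]_d) : size (gpoly r) = d.+1.
Proof. by rewrite /gpoly size_polyDl size_polyXn// ltnS size_poly. Qed.

Lemma gpoly_monic d (r : 'rV[F]_d) : gpoly r \is monic.
Proof. by rewrite monicE /gpoly lead_coefDl ?lead_coefXn// size_polyXn ltnS size_poly. Qed.

Lemma gpoly_surj g d : g \is monic -> size g = d.+1 -> exists r : 'rV_d, g = gpoly r.
Proof.
move=> gm sg; exists (poly_rV (g - 'X^d)); rewrite /gpoly poly_rV_K; first by rewrite addrC subrK.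
apply/leq_sizeP => j; rewrite leq_eqVlt coefB coefXn => /orP[/eqP<-|dj].
  by rewrite eqxx -[d]/(d.+1.-1) -sg -lead_coefE (monicP gm) subrr.
by rewrite nth_default ?sg// gtn_eqF// subrr.
Qed.

Definition irr_set d : {set 'rV[F]_d} := [set r | asbool (irreducible_poly (gpoly r))].

(** A union bound: [X] may be counted once for each [g] with [Vg X g] nonzero. The index [d] stands
    for degree [d + 1]. *)
Lemma uset_sum n : (0 < n)%N ->
  (#|uset F n| <= \sum_(d < n) \sum_(r in irr_set d.+1)
                    \sum_(k < n.+1) #|uset_at (gpoly r) k n|)%N.
Proof.
move=> n0.
have := leq_card_bigcup xpredT (fun d : 'I_n =>
  \bigcup_(r in irr_set d.+1) \bigcup_(k < n.+1) uset_at (gpoly r) k n).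
move=> H; apply: (@leq_trans _ _ _ _ (leq_trans H _)).
  apply/subset_leq_card/subsetP => X uX.
  have [g [gm irr gX sg]] := exists_irr_factor X n0.
  have [d sgd] : exists d, size g = d.+2.
    by have [+ _] := irr; case: (size g) => [|[|d]] // _; exists d.
  have dn : (d < n)%N by rewrite sgd ltnS in sg.
  have [r gE] := gpoly_surj gm sgd.
  apply/bigcupP; exists (Ordinal dn) => //=; apply/bigcupP; exists r.
    by rewrite inE -gE; apply/asboolP.
  have kn : (\rank (Vg X g) < n.+1)%N by rewrite ltnS rank_leq_row.
  by apply/bigcupP; exists (Ordinal kn) => //; rewrite inE uX -gE gX /=.
apply: leq_sum => d _; apply: leq_trans (leq_card_bigcup _ _) _.
by apply: leq_sum => r _; apply: leq_card_bigcup.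
Qed.

Lemma card_irr_set1 : (#|irr_set 1| <= q)%N.
Proof. by rewrite (leq_trans (max_card _))// card_mx. Qed.

(** In degree at least 2 the constant term is nonzero, as otherwise ['X] would be a proper
    factor. *)
Lemma card_irr_set d : (#|irr_set d.+2| <= q ^ d.+2 - q ^ d.+1)%N.
Proof.
pose Z := [set r : 'rV[F]_d.+2 | r 0 0 == 0].
have IZ : irr_set d.+2 \subset ~: Z.
  apply/subsetP => r; rewrite !inE => /asboolP [_ irr]; apply/negP => /eqP r0.
  have Xg : 'X %| gpoly r.
    rewrite -['X]subr0 -[0]/(0%:P) dvdp_XsubCl /root horner_coef0 /gpoly coefD coefXn add0r.
    by rewrite (coef_rVpoly_ord r ord0) r0.
  have /irr/(_ Xg)/eqp_size : size ('X : {poly F}) != 1 by rewrite size_polyX.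
  by rewrite size_polyX size_gpoly.
apply: leq_trans (subset_leq_card IZ) _; rewrite cardsCs setCK card_mx mul1n leq_sub2l//.
have -> : (q ^ d.+1)%N = #|[set (row_mx 0 u : 'rV[F]_(1 + d.+1)) | u in [set: 'rV[F]_d.+1]]|.
  by rewrite card_imset ?cardsT ?card_mx ?mul1n// => u v /eq_row_mx [].
apply/subset_leq_card/subsetP => _ /imsetP [u _ ->]; rewrite inE.
by rewrite mxE; case: splitP => [j _|j //]; rewrite mxE.
Qed.

End Irr.

(** * The recursion and its solution *)

Section OmBound.
Variable K : realFieldType.
Implicit Types z : K.

(** [1 - z - z ^ 2] starts Euler's pentagonal series; the surplus [t = z ^ m.+2] makes the induction
    close, each step gaining [t * (z ^ 2 - t)]. *)
Lemma om_lower z m : 0 <= z <= 1 -> 1 - z - z ^+ 2 + z ^+ m.+2 <= om z m.+1.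
Proof.
move=> /andP[z0 z1]; elim: m => [|m IH].
  by rewrite omS /om big_ord0; lra.
rewrite omS; have t0 : 0 <= z ^+ m.+2 by rewrite exprn_ge0.
have t1 : z ^+ m.+2 <= z ^+ 2.
  by rewrite -[m.+2]addn2 exprD ler_piMl ?exprn_ge0// exprn_ile1.
rewrite [z ^+ m.+3]exprS; set t := z ^+ m.+2 in IH t0 t1 *.
have t1' : t <= 1 by apply: le_trans t1 _; rewrite exprn_ile1.
apply: le_trans (_ : (1 - z - z ^+ 2 + t) * (1 - t) <= _); last first.
  by rewrite ler_wpM2r// subr_ge0.
by rewrite -subr_ge0 (_ : _ - _ = t * (z ^+ 2 - t)); [rewrite mulr_ge0 ?subr_ge0 | ring].
Qed.

(** [Etwo] is [1 / om z 2 - 1 / (1 - z)]; [Einf] is the same difference with [om] replaced by its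
    lower bound [1 - z - z ^ 2]. *)
Definition Einf z : K := z ^+ 2 / ((1 - z) * (1 - z - z ^+ 2)).
Definition Etwo z : K := z ^+ 2 / ((1 - z) * (1 - z ^+ 2)).

Lemma om_E2 z : 0 <= z <= 2^-1 -> (om z 2)^-1 - (1 - z)^-1 = Etwo z.
Proof.
move=> /andP[z0 z1]; rewrite /Etwo !omS /om big_ord0 mul1r expr1.
have a : 1 - z != 0 by rewrite gt_eqF//; lra.
have b : 1 - z ^+ 2 != 0 by rewrite gt_eqF//; nra.
by field; rewrite a b.
Qed.

Lemma om_Einf z m : 0 <= z <= 2^-1 -> (om z m.+1)^-1 - (1 - z)^-1 <= Einf z.
Proof.
move=> /andP[z0 z1]; have c : 0 < 1 - z - z ^+ 2 by nra.
have a : 1 - z != 0 by rewrite gt_eqF//; lra.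
have b : 1 - z - z ^+ 2 != 0 by rewrite gt_eqF.
have h : 1 - z - z ^+ 2 <= om z m.+1.
  have zz : 0 <= z <= 1 by lra.
  by apply: le_trans (om_lower m zz); rewrite lerDl exprn_ge0.
apply: le_trans (_ : (1 - z - z ^+ 2)^-1 - (1 - z)^-1 <= _).
  by rewrite lerB// lef_pV2// posrE// (lt_le_trans c).
rewrite le_eqVlt; apply/orP; left; apply/eqP; rewrite /Einf.
by field; rewrite a b.
Qed.

Lemma Einf_ge0 z : 0 <= z <= 2^-1 -> 0 <= Einf z.
Proof.
move=> /andP[z0 z1]; rewrite /Einf divr_ge0 ?exprn_ge0// mulr_ge0//; first lra.
nra.
Qed.

Lemma Etwo_ge0 z : 0 <= z <= 2^-1 -> 0 <= Etwo z.
Proof.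
move=> /andP[z0 z1]; rewrite /Etwo divr_ge0 ?exprn_ge0// mulr_ge0//; first lra.
nra.
Qed.

Lemma Einf_le z u : 0 <= z <= u -> u <= 2^-1 ->
  Einf z <= z ^+ 2 / ((1 - u) * (1 - u - u ^+ 2)).
Proof.
move=> /andP[z0 zu] u1; rewrite /Einf ler_wpM2l ?exprn_ge0// lef_pV2 ?posrE.
- by rewrite ler_pM//; first lra; nra.
- by rewrite mulr_gt0//; first lra; nra.
- by rewrite mulr_gt0//; first lra; nra.
Qed.

End OmBound.

Section Recursion.
Variables (F : finFieldType) (K : realFieldType).
Local Notation q := #|F|.
Local Notation "m %:K" := (m%:R : K) (at level 2, left associativity, format "m %:K").
Let y : K := q%:K^-1.

(** The factor [q ^ n] is multiplicative along [n = k + (n - k)] and cancels the [q ^ -k] in the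
    bound for [eta]. *)
Definition W n : K := q%:K ^+ n * (#|uset F n|%:R / (gl F n)%:R).

Lemma W_ge0 n : 0 <= W n.
Proof. by rewrite mulr_ge0 ?exprn_ge0 ?divr_ge0. Qed.

Lemma W0 : W 0 <= 1.
Proof.
rewrite /W expr0 mul1r ler_pdivrMr ?glK_gt0// mul1r ler_nat.
by apply: leq_trans (gl_gt0 F 0); rewrite (leq_trans (max_card _))// card_mx.
Qed.

Lemma q_gt0 : 0 < q%:K.
Proof. by rewrite ltr0n (ltn_trans _ (card_F_gt1 F)). Qed.

Lemma y_bnd : 0 <= y <= 2^-1.
Proof.
rewrite /y invr_ge0 ltW ?q_gt0//= lef_pV2 ?posrE ?q_gt0//.
by rewrite ler_nat card_F_gt1.
Qed.

Lemma yX_bnd d : 0 <= y ^+ d.+1 <= 2^-1.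
Proof.
have /andP[y0 yh] := y_bnd; have y1 : y <= 1 by apply: le_trans yh _; lra.
by rewrite exprn_ge0//= exprS; apply: le_trans yh; rewrite ler_piMr// exprn_ile1.
Qed.

Lemma uset_at_W (g : {poly F}) k n : (k <= n)%N -> g \is monic -> irreducible_poly g ->
  q%:K ^+ n * (#|uset_at g k n|%:R / (gl F n)%:R) <= q%:K ^+ k * eta g n K k * W (n - k).
Proof.
move=> kn gm irr; have e : n = (k + (n - k))%N by rewrite subnKC.
move: (n - k)%N e => l -> {n kn}; rewrite /W /eta.
rewrite mulrACA -exprD ler_pM2l ?exprn_gt0 ?q_gt0//.
rewrite ler_pdivrMr ?glK_gt0// mulrACA -invfM [leRHS]mulrAC ler_pdivlMr ?mulr_gt0 ?glK_gt0//.
rewrite -!natrM ler_nat mulnA [leqRHS]mulnC mulnA; exact: uset_at_count.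
Qed.

Lemma W_sum n : (0 < n)%N ->
  W n <= \sum_(d < n) \sum_(r in irr_set F d.+1)
           \sum_(k < n.+1) q%:K ^+ k * eta (gpoly r) n K k * W (n - k).
Proof.
move=> n0; rewrite /W mulrCA.
have c0 : 0 <= q%:K ^+ n / (gl F n)%:R by rewrite divr_ge0 ?exprn_ge0.
have := uset_sum F n0; rewrite -(ler_nat K) => /(ler_wpM2r c0) /le_trans; apply.
rewrite natr_sum mulr_suml; apply: ler_sum => d _.
rewrite natr_sum mulr_suml; apply: ler_sum => r; rewrite inE => /asboolP irr.
rewrite natr_sum mulr_suml; apply: ler_sum => k _; rewrite mulrCA.
have kn : (k <= n)%N by rewrite -ltnS.
exact: (uset_at_W kn (gpoly_monic r) irr).
Qed.

(** A noncyclic primary module has at least two composition factors; exactly two allow the sharper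
    [Etwo], more get the uniform [Einf]. *)
Lemma eta_W d (r : 'rV[F]_d.+1) n k : irreducible_poly (gpoly r) -> (k <= n)%N ->
  q%:K ^+ k * eta (gpoly r) n K k <=
    if (k < d.+1 * 2)%N then 0 else if k == (d.+1 * 2)%N then Etwo (y ^+ d.+1)
    else Einf (y ^+ d.+1).
Proof.
move=> irr kn; set g := gpoly r.
have gm : g \is monic := gpoly_monic r.
have gd : (size g).-1 = d.+1 by rewrite size_gpoly.
set z := y ^+ d.+1; have zb : 0 <= z <= 2^-1 := yX_bnd d.
have := divn_eq k d.+1; set M := (k %/ _)%N; have rd : (k %% d.+1 < d.+1)%N by rewrite ltn_mod.
move: (k %% d.+1)%N rd => s sd kE; rewrite mulnC in kE.
case: s sd kE => [|s] sd kE; last first.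
  have -> : eta g n K k = 0 by rewrite kE -gd eta_non_dvd ?gd.
  by rewrite mulr0; case: ifP => // _; case: ifP => _; [apply: Etwo_ge0 | apply: Einf_ge0].
rewrite addn0 in kE.
case: (posnP M) => [M0|M0].
  by rewrite kE M0 muln0 eta0 mulr0 lexx.
have h : q%:K ^+ k * eta g n K k <= (om z M)^-1 - (1 - z)^-1.
  have Mn : (0 < M <= n)%N by rewrite M0 /= (leq_trans _ kn)// kE leq_pmull.
  have := @eta_dvd F g n gm irr K M Mn; rewrite gd -kE -/y -/z => h.
  apply: le_trans (ler_wpM2l _ h) _; first by rewrite exprn_ge0// ltW ?q_gt0.
  by rewrite mulrA -exprMn mulfV ?expr1n ?mul1r// gt_eqF ?q_gt0.
apply: le_trans h _; rewrite kE ltn_pmul2l// eqn_pmul2l//.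
case: M M0 {kE} => [|[|[|M]]] // _ /=.
- by rewrite /om big_ord1 expr1 subrr.
- by rewrite om_E2.
- exact: om_Einf.
Qed.

(** [T n] is [W (n - 3) + ... + W 0] and [V n] is [W (n - 2)]. As filtered sums they are empty for
    small [n], where truncated subtraction would yield a spurious [W 0]. *)
Definition T n := \sum_(k < n.+1 | (2 < k)%N) W (n - k).
Definition V n := \sum_(k < n.+1 | k == 2 :> nat) W (n - k).

Lemma T_ge0 n : 0 <= T n.
Proof. by apply: sumr_ge0 => i _; apply: W_ge0. Qed.

Lemma inner_sum1 (r : 'rV[F]_1) n : irreducible_poly (gpoly r) ->
  \sum_(k < n.+1) q%:K ^+ k * eta (gpoly r) n K k * W (n - k)
  <= Etwo y * V n + Einf y * T n.
Proof.
move=> irr; rewrite /V /T !mulr_sumr [X in _ <= X + _]big_mkcond [X in _ <= _ + X]big_mkcond -big_split /=.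
apply: ler_sum => k _; have kn : (k <= n)%N by rewrite -ltnS.
have := @eta_W 0 r n k irr kn; rewrite mul1n expr1.
case: ltngtP => [k2|k2|k2] /= h; rewrite ?addr0 ?add0r.
- by rewrite mulr_le0_ge0// W_ge0.
- by rewrite ler_wpM2r ?W_ge0.
- by rewrite ler_wpM2r ?W_ge0.
Qed.

(** A noncyclic part for [g] of degree at least 2 has size at least 4, so [k = 2] contributes
    nothing. *)
Lemma inner_sum d (r : 'rV[F]_d.+2) n : irreducible_poly (gpoly r) ->
  \sum_(k < n.+1) q%:K ^+ k * eta (gpoly r) n K k * W (n - k) <= Einf (y ^+ d.+2) * T n.
Proof.
move=> irr; rewrite /T mulr_sumr [leRHS]big_mkcond.
apply: ler_sum => k _; have kn : (k <= n)%N by rewrite -ltnS.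
have := @eta_W d.+1 r n k irr kn; have zb := yX_bnd d.+1.
have E0 := Einf_ge0 zb.
have E2 : Etwo (y ^+ d.+2) <= Einf (y ^+ d.+2).
  by rewrite -om_E2//; apply: om_Einf.
case: (leqP k 2) => [k2|k2] /= h.
  rewrite mulr_le0_ge0 ?W_ge0//; apply: le_trans h _; rewrite ifT//.
  by apply: leq_ltn_trans k2 _; rewrite mulnC !mulnS; lia.
rewrite ler_wpM2r ?W_ge0//; apply: le_trans h _.
by case: ifP => // _; case: ifP.
Qed.

(** The denominator of [Einf] frozen at [y ^ 2], the largest [z] from degrees at least 2. *)
Definition Cq : K := ((1 - y ^+ 2) * (1 - y ^+ 2 - y ^+ 4))^-1.

Lemma Cq_ge0 : 0 <= Cq.
Proof.
rewrite /Cq invr_ge0 (exprM y 2 2); have /andP[] := yX_bnd 1.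
by move: (y ^+ 2) => z z0 z1; apply: mulr_ge0; [lra|nra].
Qed.

(** With [Einf z <= z ^ 2 * Cq], the term for [d] is at most [(y ^ (d + 2) - y ^ (d + 3)) * Cq], and
    the sum telescopes. *)
Lemma outer_sum n :
  \sum_(d < n) (q%:K ^+ d.+2 - q%:K ^+ d.+1) * Einf (y ^+ d.+2) <= y ^+ 2 * Cq.
Proof.
have /andP[y0 y1] := y_bnd; have qy : q%:K * y = 1 by rewrite mulfV ?gt_eqF ?q_gt0.
have C0 := Cq_ge0.
suff h : \sum_(d < n) (q%:K ^+ d.+2 - q%:K ^+ d.+1) * Einf (y ^+ d.+2)
         <= (y ^+ 2 - y ^+ n.+2) * Cq.
  by apply: le_trans h _; rewrite ler_wpM2r// lerBlDr lerDl exprn_ge0.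
elim: n => [|n IH]; first by rewrite big_ord0 subrr mul0r.
rewrite big_ord_recr /=.
suff h : (q%:K ^+ n.+2 - q%:K ^+ n.+1) * Einf (y ^+ n.+2) <= (y ^+ n.+2 - y ^+ n.+3) * Cq.
  by apply: le_trans (lerD IH h) _; rewrite -mulrDl addrA subrK.
have zy : 0 <= y ^+ n.+2 <= y ^+ 2.
  by rewrite exprn_ge0//= -addn2 exprD ler_piMl ?exprn_ge0// exprn_ile1//; apply: le_trans y1 _; lra.
have y2 : y ^+ 2 <= 2^-1 by have /andP[] := yX_bnd 1.
have CE : ((1 - y ^+ 2) * (1 - y ^+ 2 - y ^+ 2 ^+ 2))^-1 = Cq by rewrite -exprM.
have h := Einf_le zy y2; rewrite CE in h.
have q1 : 0 <= q%:K ^+ n.+2 - q%:K ^+ n.+1.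
  rewrite subr_ge0 [leRHS]exprS ler_peMl ?exprn_ge0 ?ltW ?q_gt0//.
  by rewrite (ltr_nat _ 1) card_F_gt1.
apply: le_trans (ler_wpM2l q1 h) _; rewrite mulrA ler_wpM2r//.
rewrite le_eqVlt; apply/orP; left; apply/eqP; rewrite mulrBl.
have qyn m : q%:K ^+ m * y ^+ m = 1 by rewrite -exprMn qy expr1n.
have -> : q%:K ^+ n.+2 * y ^+ n.+2 ^+ 2 = y ^+ n.+2 by rewrite expr2 mulrA qyn mul1r.
have -> // : q%:K ^+ n.+1 * y ^+ n.+2 ^+ 2 = y ^+ n.+3.
transitivity (q%:K ^+ n.+1 * y ^+ n.+1 * (y * y ^+ n.+2)); last by rewrite qyn mul1r -exprS.
by rewrite expr2 {1}[y ^+ n.+2]exprS !mulrA [_ * y * y ^+ n.+1]mulrAC.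
Qed.

Lemma W_rec n : (0 < n)%N ->
  W n <= q%:K * Etwo y * V n + (q%:K * Einf y + y ^+ 2 * Cq) * T n.
Proof.
move=> n0; apply: le_trans (W_sum n0) _; case: n n0 => // n _; rewrite big_ord_recl.
have h1 : \sum_(r in irr_set F 1) \sum_(k < n.+2) q%:K ^+ k * eta (gpoly r) n.+1 K k * W (n.+1 - k)
    <= q%:K * (Etwo y * V n.+1 + Einf y * T n.+1).
  apply: le_trans (ler_sum _ (_ : forall r, r \in irr_set F 1 -> _ <=
      Etwo y * V n.+1 + Einf y * T n.+1)) _.
    by move=> r; rewrite inE => /asboolP; apply: inner_sum1.
  rewrite sumr_const -[leLHS]mulr_natl ler_wpM2r ?ler_nat ?card_irr_set1//.
  have yb := y_bnd.
  rewrite addr_ge0// mulr_ge0 ?Etwo_ge0 ?Einf_ge0 ?T_ge0//.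
  by apply: sumr_ge0 => i _; apply: W_ge0.
have h2 : \sum_(d < n) \sum_(r in irr_set F d.+2)
    \sum_(k < n.+2) q%:K ^+ k * eta (gpoly r) n.+1 K k * W (n.+1 - k)
    <= \sum_(d < n) (q%:K ^+ d.+2 - q%:K ^+ d.+1) * Einf (y ^+ d.+2) * T n.+1.
  apply: ler_sum => d _.
  apply: le_trans (ler_sum _ (_ : forall r, r \in irr_set F d.+2 -> _ <=
      Einf (y ^+ d.+2) * T n.+1)) _.
    by move=> r; rewrite inE => /asboolP; apply: inner_sum.
  rewrite sumr_const -[leLHS]mulr_natl -[leRHS]mulrA ler_wpM2r//.
    by rewrite mulr_ge0 ?T_ge0// Einf_ge0// yX_bnd.
  rewrite -!natrX -natrB; first by rewrite ler_nat card_irr_set.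
  by rewrite leq_exp2l ?card_F_gt1.
apply: le_trans (lerD h1 h2) _; rewrite -mulr_suml mulrDr !mulrA -addrA lerD2l -mulrDl.
by rewrite ler_wpM2r ?T_ge0// lerD2l outer_sum.
Qed.

Lemma V_small n : (n < 2)%N -> V n = 0.
Proof.
move=> n2; apply: big1 => i /eqP E; have := ltn_ord i; rewrite E ltnS => h.
by have := leq_trans h n2; rewrite ltnn.
Qed.

Lemma V_S2 n : V n.+2 = W n.
Proof.
have p2 : (2 < n.+3)%N by [].
rewrite /V (big_pred1 (Ordinal p2)) => [|i]; first by rewrite /= subSS subSS subn0.
by [].
Qed.

Lemma T_small n : (n < 3)%N -> T n = 0.
Proof.
move=> n3; apply: big1 => i i2; have := ltn_ord i; rewrite ltnS => h.
by have := leq_trans (leq_trans i2 h) (n3 : (n <= 2)%N); rewrite ltnn.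
Qed.

Lemma T_S3 n : T n.+3 = \sum_(j < n.+1) W j.
Proof.
rewrite /T (reindex_inj rev_ord_inj) /=.
have le : (n.+1 <= n.+4)%N by lia.
rewrite -(big_ord_narrow le (F := W)); apply: eq_big => j; have := ltn_ord j; first by lia.
by move=> jn _; congr W; lia.
Qed.

(** [W 0] may exceed [A], so initial sums are compared with [t * B ^ j] for [t = A / (B - 1)]. The
    first condition is [1 <= t * B ^ 2], the next two settle [n = 2] and [n = 3], and the last is
    the inductive step. *)
Lemma W_bound (A B : K) : 0 < A -> 1 < B ->
  let a2 := q%:K * Etwo y in let a := q%:K * Einf y + y ^+ 2 * Cq in
  B - 1 <= A * B ^+ 2 -> a2 <= A * B ^+ 2 -> a <= A * B ^+ 3 ->
  a2 * A + a * (A / (B - 1)) <= A * B ^+ 2 ->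
  forall n, (0 < n)%N -> W n <= A * B ^+ n.
Proof.
move=> A0 B1 a2 a c1 b2 b3 c2.
have B0 : 0 < B by lra.
have B10 : 0 < B - 1 by lra.
have yb := y_bnd.
have a20 : 0 <= a2 by rewrite mulr_ge0 ?Etwo_ge0.
have a0 : 0 <= a.
  apply: addr_ge0; first by rewrite mulr_ge0 ?Einf_ge0.
  by apply: mulr_ge0 Cq_ge0; apply: exprn_ge0; case/andP: yb.
set t := A / (B - 1); have t0 : 0 <= t by rewrite divr_ge0// ltW.
have W1 : W 1 = 0.
  apply/eqP; rewrite eq_le W_ge0 andbT; apply: le_trans (W_rec _) _ => //.
  by rewrite V_small// T_small// !mulr0 addr0.
elim/ltn_ind => -[|[|[|[|n]]]] // IH _.
- by rewrite W1 mulr_ge0 ?exprn_ge0 ?ltW.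
- apply: le_trans (W_rec _) _ => //; rewrite V_S2 T_small// mulr0 addr0 -/a2.
  by apply: le_trans b2; rewrite -[leRHS]mulr1 ler_wpM2l// W0.
- apply: le_trans (W_rec _) _ => //; rewrite V_S2 W1 mulr0 add0r -/a T_S3 big_ord1.
  by apply: le_trans b3; rewrite -[leRHS]mulr1 ler_wpM2l// W0.
have hs j : (j < n.+2)%N -> \sum_(i < j.+2) W i <= t * B ^+ j.+2.
  elim: j => [|j IHj] jn.
    rewrite !big_ord_recl big_ord0 /= W1 addr0 addr0; apply: le_trans W0 _.
    by rewrite /t mulrAC ler_pdivlMr// mul1r.
  have j2 : (j.+2 < n.+4)%N by apply: ltnW jn.
  rewrite big_ord_recr /=; apply: le_trans (lerD (IHj (ltnW jn)) (IH j.+2 j2 isT)) _.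
  rewrite le_eqVlt; apply/orP; left; apply/eqP.
  have : t * (B - 1) = A by rewrite /t mulfVK// gt_eqF.
  by move=> <-; rewrite [B ^+ j.+3]exprS; ring.
apply: le_trans (W_rec _) _ => //; rewrite V_S2 T_S3 -/a2 -/a.
have h1 := ler_wpM2l a20 (IH n.+2 (leqnSn _) isT).
have h2 := ler_wpM2l a0 (hs n (leqnSn _)).
apply: le_trans (lerD h1 h2) _.
rewrite [a2 * _]mulrA [a * _]mulrA -mulrDl.
apply: le_trans (ler_wpM2r _ c2) _; first by rewrite exprn_ge0// ltW.
by rewrite -mulrA -exprD.
Qed.

End Recursion.

(** * The explicit bounds for q >= 4 and q = 3 *)

Section UncBound.
Variables (F : finFieldType) (K : realFieldType).
Local Notation q := #|F|.
Local Notation "m %:K" := (m%:R : K) (at level 2, left associativity, format "m %:K").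

Lemma unc_W n (c : K) : W F K n <= c -> (unc F n)%:K * q%:K ^+ n <= c * q%:K ^+ (n * n).
Proof.
move=> Wc; have glp := glK_gt0 F K n.
have u : (unc F n <= #|uset F n|)%N.
  apply/subset_leq_card/subsetP => X; rewrite !inE => /asboolP uX.
  by apply/asboolP/uncyclic_weak.
apply: le_trans (_ : W F K n * (gl F n)%:K <= _); last first.
  apply: le_trans (ler_wpM2r (ltW glp) Wc) _; rewrite ler_wpM2l//.
    exact: le_trans (W_ge0 _ _ _) Wc.
  by rewrite -natrX ler_nat gl_le.
rewrite /W -mulrA divfK ?gt_eqF// mulrC ler_wpM2l ?exprn_ge0// ler_nat.
exact: u.
Qed.

Lemma lef_inv_mul (a b : K) : 0 < a -> 1 <= a * b -> a^-1 <= b.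
Proof. by move=> a0 ab; rewrite -[a^-1]mul1r ler_pdivrMr// mulrC. Qed.

Lemma unc_bound_ge4 n (y := q%:K^-1) : (4 <= q)%N -> (0 < n)%N ->
  (unc F n)%:K * q%:K ^+ n <= y * (1 + y + 2 * y ^+ 2) ^+ n * q%:K ^+ (n * n).
Proof.
move=> q4 n0; apply: unc_W; have q0 : 0 < q%:K := q_gt0 F K.
have y0 : 0 < y by rewrite invr_gt0.
have qy : q%:K * y = 1 by rewrite mulfV// gt_eqF.
have y4 : y <= 4^-1 by rewrite lef_pV2 ?posrE// (ler_nat _ 4).
have E2 : q%:K * Etwo y = y * ((1 - y) * (1 - y ^+ 2))^-1.
  by rewrite /Etwo expr2 !mulrA qy mul1r.
have E3 : q%:K * Einf y = y * ((1 - y) * (1 - y - y ^+ 2))^-1.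
  by rewrite /Einf expr2 !mulrA qy mul1r.
(* Each reciprocal is majorised by a truncated power series whose last coefficient is raised to
   absorb the tail for [y <= 1/4]: 3 for 2 in [p2], [61/5] for 7 in [p3], 3 for 2 in [pC]. *)
have p2 : ((1 - y) * (1 - y ^+ 2))^-1 <= 1 + y + 3 * y ^+ 2.
  apply: lef_inv_mul; first by apply: mulr_gt0; nra.
  rewrite -subr_ge0 (_ : _ - 1 = y ^+ 2 * (1 - 3 * y - 2 * y ^+ 2 + 3 * y ^+ 3)); last by ring.
  by rewrite mulr_ge0 ?exprn_ge0 ?ltW//; nra.
have p3 : ((1 - y) * (1 - y - y ^+ 2))^-1 <= 1 + 2 * y + 4 * y ^+ 2 + 61 / 5 * y ^+ 3.
  apply: lef_inv_mul; first by apply: mulr_gt0; nra.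
  rewrite -subr_ge0 (_ : _ - 1 = y ^+ 3 * (26 / 5 - 112 / 5 * y + 4 * y ^+ 2 + 61 / 5 * y ^+ 3)); last by field.
  by rewrite mulr_ge0 ?exprn_ge0 ?ltW//; nra.
have pC : Cq F K <= 1 + 3 * y ^+ 2.
  have [z0 z1] : 0 < y ^+ 2 /\ y ^+ 2 <= 16^-1 by split; nra.
  rewrite /Cq -/y (exprM y 2 2); move: (y ^+ 2) z0 z1 => z z0 z1.
  by apply: lef_inv_mul; [apply: mulr_gt0 | ]; nra.
have B1 : 1 < 1 + y + 2 * y ^+ 2 by nra.
have t : y / (1 + y + 2 * y ^+ 2 - 1) = (1 + 2 * y)^-1.
  rewrite (_ : 1 + y + _ - 1 = y * (1 + 2 * y)); last by ring.
  by rewrite invfM mulrA divff ?mul1r// gt_eqF.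
apply: W_bound => //; rewrite -/y ?E2 ?E3 ?t.
- nra.
- by rewrite ler_pM2l//; nra.
- have : Cq F K * y <= (1 + 3 * y ^+ 2) * y by rewrite ler_pM2r.
  rewrite expr2 -mulrA -mulrDr ler_pM2l// [y * Cq F K]mulrC; nra.
- move: p2 p3 pC; set P2 := _^-1; set P3 := _^-1; move: (Cq F K) => C p2 p3 pC.
  have y2 : 0 < 1 + 2 * y by lra.
  rewrite -(ler_pM2r y2) mulrDl divfK ?gt_eqF//.
  rewrite [leLHS](_ : _ = y * (y * (1 + 2 * y) * P2 + P3 + y * C)); last by ring.
  rewrite -[leRHS]mulrA ler_pM2l//.
  have h1 : y * (1 + 2 * y) * P2 <= y * (1 + 2 * y) * (1 + y + 3 * y ^+ 2).
    by rewrite ler_pM2l// mulr_gt0.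
  have h2 : y * C <= y * (1 + 3 * y ^+ 2) by rewrite ler_pM2l.
  apply: le_trans (lerD (lerD h1 p3) h2) _.
  rewrite -subr_ge0 (_ : _ - _ =
    y ^+ 2 * (2 - 31 / 5 * y + 6 * y ^+ 2 + 8 * y ^+ 3)); last by field.
  by rewrite mulr_ge0 ?exprn_ge0 ?ltW//; nra.
Qed.

(** The coefficients of the recursion are evaluated exactly at [q = 3]; the choice [A = 1/2] keeps
    [3 * A] below 1.56. *)
Lemma unc_bound_3 n : q = 3 -> (0 < n)%N ->
  (unc F n)%:K * q%:K ^+ n <= 1 / 2 * (159 / 100) ^+ n * q%:K ^+ (n * n).
Proof.
move=> q3 n0; apply: unc_W.
have e2 : q%:K * Etwo q%:K^-1 = 9 / 16.
  by rewrite /Etwo q3 [(1 - _) * _](_ : _ = 16 / 27); field.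
have e3 : q%:K * Einf q%:K^-1 = 9 / 10.
  by rewrite /Einf q3 [(1 - _) * _](_ : _ = 10 / 27); field.
have c : Cq F K = 729 / 568.
  by rewrite /Cq q3 [(1 - _) * _](_ : _ = 568 / 729); field.
have t : 1 / 2 / (159 / 100 - 1) = 50 / 59 :> K.
  by rewrite [_ - 1](_ : _ = 59 / 100); field.
by apply: W_bound => //; rewrite ?e2 ?e3 ?c ?t ?q3; lra.
Qed.

End UncBound.

(* Transfer to the real numbers *)
From mathcomp Require Import Rstruct.
From Stdlib Require Import Reals ZArith.
Local Open Scope R_scope.

Lemma unc_bound_ge4_R (F : finFieldType) (n : nat) (q := INR #|F|) : (4 <= #|F|)%nat -> (0 < n)%nat ->
  INR (unc F n) * q ^ n <= / q * (1 + / q + 2 / q ^ 2) ^ n * q ^ (n * n)%nat.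
Proof.
move=> q4 n0; have /RleP := @unc_bound_ge4 F R n q4 n0.
rewrite -!INRE -!RpowE -/q => h.
have -> : 2 / q ^ 2 = INR 2 * (/ q) ^ 2 by rewrite pow_inv.
exact: h.
Qed.

Lemma unc_bound_3_R (F : finFieldType) (n : nat) : #|F| = 3%nat -> (0 < n)%nat ->
  INR (unc F n) * 3 ^ n <= 1 / 2 * (159 / 100) ^ n * 3 ^ (n * n)%nat.
Proof.
move=> q3 n0; have /RleP := @unc_bound_3 F R n q3 n0.
rewrite q3 -!INRE -!RpowE => h.
have E m : IZR (Z.of_nat m) = INR m by rewrite INR_IZR_INZ.
rewrite -[3]/(IZR (Z.of_nat 3)) -[100]/(IZR (Z.of_nat 100))
  -[159]/(IZR (Z.of_nat 159)) !E.
exact: h.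
Qed.

(** The exponent is -1 at [n = 1], hence an integer power. *)
Lemma powerRZ_exponent (q : R) (n : nat) : q <> 0 ->
  powerRZ q (Z.of_nat (n * n)%nat - Z.of_nat n - 1) * q ^ n * q = q ^ (n * n)%nat.
Proof.
move=> q0; rewrite !pow_powerRZ -[X in _ * X]powerRZ_1 -!powerRZ_add //.
by congr powerRZ; lia.
Qed.

Theorem theorem5p3 :
  (forall (F : finFieldType) (n : nat), (1 <= n)%nat -> #|F| = 3%nat ->
     INR (unc F n) <
       (156 / 100) * powerRZ 3 (Z.of_nat (n * n) - Z.of_nat n - 1) * (159 / 100) ^ n) /\
  (forall (F : finFieldType) (n : nat), (1 <= n)%nat -> (4 <= #|F|)%nat ->
     let q := INR #|F| in
     INR (unc F n) <
       cstar q * powerRZ q (Z.of_nat (n * n) - Z.of_nat n - 1)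
         * (1 + / q + 2 / q ^ 2) ^ n) /\
  (forall (F : finFieldType), (3 <= #|F|)%nat ->
     1 < cstar (INR #|F|) < (156 / 100)).
Proof.
split; last split.
- move=> F n n0 q3; have h := @unc_bound_3_R F n q3 n0.
  have e := @powerRZ_exponent 3 n ltac:(Lra.lra).
  have p3 : 0 < 3 ^ n by apply: pow_lt; Lra.lra.
  have pz : 0 < powerRZ 3 (Z.of_nat (n * n) - Z.of_nat n - 1) by apply: powerRZ_lt; Lra.lra.
  have pB : 0 < (159 / 100) ^ n by apply: pow_lt; Lra.lra.
  apply: (Rmult_lt_reg_r _ _ _ p3); apply: Rle_lt_trans h _.
  (* After cancellation the claim is [3 * (1/2) < 156/100]. *)
  rewrite -e; set z := powerRZ _ _ in pz *; set B := (159 / 100) ^ n in pB *.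
  by have := Rmult_lt_0_compat _ _ (Rmult_lt_0_compat _ _ pz p3) pB; Lra.lra.
- move=> F n n0 q4 q; have h := @unc_bound_ge4_R F n q4 n0.
  have q4R : 4 <= q.
    by rewrite -[4]/(IZR (Z.of_nat 4)) -INR_IZR_INZ; apply: le_INR; apply/ssrnat.leP.
  have [c1 _] := cstar_bounds q ltac:(Lra.lra).
  have e := @powerRZ_exponent q n ltac:(Lra.lra).
  have pq : 0 < q ^ n by apply: pow_lt; Lra.lra.
  have pz : 0 < powerRZ q (Z.of_nat (n * n) - Z.of_nat n - 1) by apply: powerRZ_lt; Lra.lra.
  have iq : 0 < / q by apply: Rinv_0_lt_compat; Lra.lra.
  have pB : 0 < (1 + / q + 2 / q ^ 2) ^ n.
    by apply: pow_lt; rewrite /Rdiv -pow_inv; have := pow_lt _ 2 iq; Lra.lra.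
  apply: (Rmult_lt_reg_r _ _ _ pq); apply: Rle_lt_trans h _.
  rewrite -e -/q; set z := powerRZ _ _ in pz *; set B := (_ ^ n) in pB *.
  (* The constant [1/q] meets the extra factor [q], so [1 < cstar q] is all that remains. *)
  have -> : / q * B * (z * q ^ n * q) = 1 * (z * B * q ^ n) by field; Lra.lra.
  have -> : cstar q * z * B * q ^ n = cstar q * (z * B * q ^ n) by ring.
  by apply: Rmult_lt_compat_r => //; do 2 apply: Rmult_lt_0_compat => //.
- move=> F q3; apply: cstar_bounds.
  by rewrite -[3]/(IZR (Z.of_nat 3)) -INR_IZR_INZ; apply: le_INR; apply/ssrnat.leP.
Qed.
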